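(* Let $X\subseteq\mathbb R^d$, $Y\subseteq\mathbb R^n$ be closed convex sets and $f:X\times Y\to\mathbb R$ continuous, with $f(\cdot,y)$ $\rho$-weakly convex on $X$ for every $y\in Y$ and $f(x,\cdot)$ $\lambda$-strongly concave on $Y$ for every $x\in X$ ($\rho,\lambda>0$). Suppose the stochastic subgradients of $f$ satisfy $\mathbb E[\|\mathcal G_x\|^2]\le M_1^2$ and $\mathbb E[\|\mathcal G_y\|^2]\le M_2^2$. Let $x_0\in X$, $y_0\in Y$, $\epsilon_0>0$ satisfy $\mathrm{Gap}(x_0,y_0)\le\epsilon_0$, let $\gamma=2\rho$ and $\epsilon>0$. Run Epoch-GDA for weakly-convex strongly-concave problems (described in the context) for $$K=\max\left\{\frac{1696\gamma\left(\frac{2M_1^2}{\rho}+\frac{M_2^2}{\lambda}\right)}{\epsilon^2}\ln\left(\frac{1696\gamma\left(\frac{2M_1^2}{\rho}+\frac{M_2^2}{\lambda}\right)}{\epsilon^2}\right),\ \frac{1376\,\gamma\,\epsilon_0}{5\epsilon^2}\right\}$$ epochs (rounded up to an integer), and let $\tau$ be sampled uniformly at random from $\{1,\dots,K\}$ independently of the algorithm. Let $(\hat x_k^*,\hat y_k^* )$ be the saddle point over $X\times Y$ of $\hat f_k(x,y)=f(x,y)+\frac\gamma2\|x-x_0^k\|^2$. Then $$\mathbb E\left[\mathrm{dist}(0,\partial P(\hat x_\tau^* ))^2\right]\ \le\ \gamma^2\,\mathbb E\left[\|\hat x_\tau^*-x_0^\tau\|^2\right]\ \le\ \epsilon^2,$$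 and the total number of iterations is $\sum_{k=1}^KT_k=\tilde O(1/\epsilon^4)$.
   Context: $\|\cdot\|$ is the Euclidean norm. $\mathrm{Gap}(x,y)=\max_{y'\in Y}f(x,y')-\min_{x'\in X}f(x',y)$. $P(x)=\max_{y\in Y}f(x,y)$ for $x\in X$, understood as $+\infty$ for $x\notin X$; $\partial P$ is its limiting Fréchet subdifferential; $\mathrm{dist}(0,S)=\inf_{v\in S}\|v\|$. $\tilde O(\cdot)$ hides logarithmic factors in $1/\epsilon$ (with constants depending on $\rho,\lambda,M_1,M_2,\epsilon_0$), as $\epsilon\to0$. A function $h$ is $\rho$-weakly convex on $X$ if $v^\top(x-x')-\frac\rho2\|x-x'\|^2\le h(x)-h(x')$ for all $x,x'\in X$, $v\in\partial h(x')$. It is $\mu$-strongly convex if $v^\top(x-x')+\frac\mu2\|x-x'\|^2\le h(x)-h(x')$ for all such $x,x',v$; $h$ is $\lambda$-strongly concave if $-h$ is $\lambda$-strongly convex. Stochastic oracle: at $(x,y)\in X\times Y$ it returns $\mathcal G_x=\partial_xf(x,y;\xi)$ and $\mathcal G_y=\partial_yf(x,y;\xi)$, with $\mathbb E[\mathcal G_x]$ a subgradient of $f(\cdot,y)$ at $x$ and $\mathbb E[\mathcal G_y]$ a supergradient of $f(x,\cdot)$ at $y$. The samples $\xi_t^k$ are fresh (independent of the past), so these properties and the second-moment bounds hold conditionally on the past. Epoch-GDA for weakly-convex strongly-concave problems: $x_0^1=x_0$, $y_0^1=y_0$, $\gamma=2\rho$. For $k=1,\dots,K$: set $T_k=\frac{106(k+1)}3$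 (rounded up to an integer), $\eta_x^k=\frac4{\rho(k+1)}$, $\eta_y^k=\frac2{\lambda(k+1)}$. For $t=0,\dots,T_k-1$ obtain $\mathcal G_{x,t}^k=\partial_xf(x_t^k,y_t^k;\xi_t^k)$, $\mathcal G_{y,t}^k=\partial_yf(x_t^k,y_t^k;\xi_t^k)$ and set $$x_{t+1}^k=\arg\min_{x\in X}\ x^\top\mathcal G_{x,t}^k+\tfrac1{2\eta_x^k}\|x-x_t^k\|^2+\tfrac\gamma2\|x-x_0^k\|^2,\qquad y_{t+1}^k=\arg\min_{y\in Y}\ -y^\top\mathcal G_{y,t}^k+\tfrac1{2\eta_y^k}\|y-y_t^k\|^2.$$ Then put $x_0^{k+1}=\bar x_k=\frac1{T_k}\sum_{t=0}^{T_k-1}x_t^k$ and $y_0^{k+1}=\bar y_k=\frac1{T_k}\sum_{t=0}^{T_k-1}y_t^k$. *)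

(* Defs.v *)
From HB Require Import structures.
From mathcomp Require Import all_boot all_order all_algebra.
From mathcomp Require Import all_classical all_reals all_analysis.

Set Implicit Arguments.
Unset Strict Implicit.
Unset Printing Implicit Defensive.

Import Order.TTheory GRing.Theory Num.Theory.
Import numFieldNormedType.Exports.

Local Open Scope classical_set_scope.
Local Open Scope ring_scope.

(* The library's norm on 'rV[R]_d, denoted by bars, is the sup norm, hence the
   separate Euclidean norm; the topology is the same. *)
Definition dot (R : realType) (d : nat) (u v : 'rV[R]_d) : R :=
  \sum_i u 0 i * v 0 i.

Definition enorm (R : realType) (d : nat) (u : 'rV[R]_d) : R :=
  Num.sqrt (dot u u).

(* dist(0, S), equal to +oo when S is empty *)
Definition dist0 (R : realType) (d : nat) (S : set 'rV[R]_d) : \bar R :=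
  ereal_inf [set (enorm v)%:E | v in S].

Definition extend (R : realType) (d : nat) (X : set 'rV[R]_d)
    (h : 'rV[R]_d -> R) (x : 'rV[R]_d) : \bar R :=
  if x \in X then (h x)%:E else +oo%E.

(* liminf_{z -> x, z <> x} (h z - h x - v^T (z - x)) / |z - x| >= 0 *)
Definition frechet_subdiff (R : realType) (d : nat) (h : 'rV[R]_d -> \bar R)
    (x : 'rV[R]_d) : set 'rV[R]_d :=
  [set v | h x \is a fin_num /\
    (0 <= limf_einf (fun z => (h z - h x - (dot v (z - x))%:E)
                              * ((enorm (z - x))^-1)%:E) x^')%E].

Definition limiting_subdiff (R : realType) (d : nat) (h : 'rV[R]_d -> \bar R)
    (x : 'rV[R]_d) : set 'rV[R]_d :=
  [set v | h x \is a fin_num /\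
    exists (u_ v_ : nat -> 'rV[R]_d),
      [/\ u_ k @[k --> \oo] --> x,
          h (u_ k) @[k --> \oo] --> h x,
          forall k, frechet_subdiff h (u_ k) (v_ k) &
          v_ k @[k --> \oo] --> v]].

(* A function given on X only is subdifferentiated after extension by +oo. *)
Definition weakly_convex (R : realType) (d : nat) (rho : R)
    (X : set 'rV[R]_d) (h : 'rV[R]_d -> R) : Prop :=
  forall x x' v, X x -> X x' -> limiting_subdiff (extend X h) x' v ->
    dot v (x - x') - rho / 2 * enorm (x - x') ^+ 2 <= h x - h x'.

Definition strongly_convex (R : realType) (d : nat) (mu : R)
    (X : set 'rV[R]_d) (h : 'rV[R]_d -> R) : Prop :=
  forall x x' v, X x -> X x' -> limiting_subdiff (extend X h) x' v ->
    dot v (x - x') + mu / 2 * enorm (x - x') ^+ 2 <= h x - h x'.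

Definition strongly_concave (R : realType) (d : nat) (lam : R)
    (X : set 'rV[R]_d) (h : 'rV[R]_d -> R) : Prop :=
  strongly_convex lam X (fun x => - h x).

Definition gap (R : realType) (d n : nat) (X : set 'rV[R]_d)
    (Y : set 'rV[R]_n) (f : 'rV[R]_d -> 'rV[R]_n -> R)
    (x : 'rV[R]_d) (y : 'rV[R]_n) : \bar R :=
  (ereal_sup [set (f x y')%:E | y' in Y]
   - ereal_inf [set (f x' y)%:E | x' in X])%E.

Definition primal (R : realType) (d n : nat) (X : set 'rV[R]_d)
    (Y : set 'rV[R]_n) (f : 'rV[R]_d -> 'rV[R]_n -> R)
    (x : 'rV[R]_d) : \bar R :=
  if x \in X then ereal_sup [set (f x y)%:E | y in Y] else +oo%E.

Definition is_saddle (R : realType) (d n : nat) (X : set 'rV[R]_d)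
    (Y : set 'rV[R]_n) (g : 'rV[R]_d -> 'rV[R]_n -> R)
    (xs : 'rV[R]_d) (ys : 'rV[R]_n) : Prop :=
  [/\ X xs, Y ys &
      forall x y, X x -> Y y -> g xs y <= g xs ys /\ g xs ys <= g x ys].

Definition is_argmin (R : realType) (d : nat) (X : set 'rV[R]_d)
    (phi : 'rV[R]_d -> R) (x : 'rV[R]_d) : Prop :=
  X x /\ forall x', X x' -> phi x <= phi x'.

(* Only meaningful for x >= 0. *)
Definition ceiln (R : realType) (x : R) : nat := `|Num.ceil x|%N.

Definition nb_steps (R : realType) (k : nat) : nat :=
  ceiln (106 * k.+1%:R / 3 : R).

(* The second term of the maximum is positive, whatever the sign of D ln D;
   since ln 0 = 0, the first term is 0 when M1 = M2 = 0. *)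
Definition nb_epochs (R : realType) (rho lam gamma M1 M2 eps0 eps : R) : nat :=
  let D := 1696 * gamma * (2 * M1 ^+ 2 / rho + M2 ^+ 2 / lam) / eps ^+ 2 in
  ceiln (Num.max (D * ln D) (1376 * gamma * eps0 / (5 * eps ^+ 2))).

Definition total_steps (R : realType) (rho lam gamma M1 M2 eps0 eps : R) : nat :=
  (\sum_(1 <= k < (nb_epochs rho lam gamma M1 M2 eps0 eps).+1) nb_steps R k)%N.

(* The calls to the oracle made during K epochs, and those made before the
   call at step t of epoch k; indices are pairs (epoch, step). *)
Definition calls (R : realType) (K : nat) : set (nat * nat) :=
  [set i | (1 <= i.1 <= K)%N && (i.2 < nb_steps R i.1)%N].

Definition calls_before (R : realType) (K k t : nat) : set (nat * nat) :=
  [set i | calls R K i /\ ((i.1 < k)%N \/ i.1 = k /\ (i.2 < t)%N)].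

Definition epoch_GDA (R : realType) (d n : nat) (X : set 'rV[R]_d)
    (Y : set 'rV[R]_n) (rho lam gamma : R) (K : nat)
    (x0 : 'rV[R]_d) (y0 : 'rV[R]_n) (S : Type)
    (Gx : 'rV[R]_d -> 'rV[R]_n -> S -> 'rV[R]_d)
    (Gy : 'rV[R]_d -> 'rV[R]_n -> S -> 'rV[R]_n)
    (xi : nat -> nat -> S)
    (x : nat -> nat -> 'rV[R]_d) (y : nat -> nat -> 'rV[R]_n) : Prop :=
  [/\ x 1 0 = x0 /\ y 1 0 = y0,
      forall k t, calls R K (k, t) ->
        let eta_x := 4 / (rho * k.+1%:R) in
        is_argmin X (fun z => dot z (Gx (x k t) (y k t) (xi k t))
                              + (2 * eta_x)^-1 * enorm (z - x k t) ^+ 2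
                              + gamma / 2 * enorm (z - x k 0) ^+ 2) (x k t.+1),
      forall k t, calls R K (k, t) ->
        let eta_y := 2 / (lam * k.+1%:R) in
        is_argmin Y (fun z => - dot z (Gy (x k t) (y k t) (xi k t))
                              + (2 * eta_y)^-1 * enorm (z - y k t) ^+ 2)
                    (y k t.+1) &
      forall k, (1 <= k <= K)%N ->
        x k.+1 0 = (nb_steps R k)%:R^-1 *: \sum_(t < nb_steps R k) x k t /\
        y k.+1 0 = (nb_steps R k)%:R^-1 *: \sum_(t < nb_steps R k) y k t].

(* Borel measurability in (x, y, s) jointly, for (x, y) in X x Y; vectors
   carry the product sigma-algebra of the coordinates, which the library
   provides on tuples. *)
Definition row_of_tuple (R : realType) (d : nat) (u : d.-tuple R) : 'rV[R]_d :=
  \row_i tnth u i.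

Definition measurable_oracle (R : realType) (d n m : nat) (X : set 'rV[R]_d)
    (Y : set 'rV[R]_n) (dS : measure_display) (S : measurableType dS)
    (G : 'rV[R]_d -> 'rV[R]_n -> S -> 'rV[R]_m) : Prop :=
  forall i : 'I_m,
    measurable_fun [set z : d.-tuple R * n.-tuple R * S |
                     X (row_of_tuple z.1.1) /\ Y (row_of_tuple z.1.2)]
      (fun z => G (row_of_tuple z.1.1) (row_of_tuple z.1.2) z.2 0 i).

Definition mean_vector (R : realType) (m : nat) (dO : measure_display)
    (Omega : measurableType dO) (P : probability Omega R)
    (V : Omega -> 'rV[R]_m) : 'rV[R]_m :=
  \row_i fine ('E_P[fun w => V w 0%R i])%E.

Definition oracle_bounds (R : realType) (d n : nat) (X : set 'rV[R]_d)
    (Y : set 'rV[R]_n) (f : 'rV[R]_d -> 'rV[R]_n -> R) (M1 M2 : R)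
    (dO dS : measure_display) (Omega : measurableType dO)
    (S : measurableType dS) (P : probability Omega R)
    (Gx : 'rV[R]_d -> 'rV[R]_n -> S -> 'rV[R]_d)
    (Gy : 'rV[R]_d -> 'rV[R]_n -> S -> 'rV[R]_n) (xi : Omega -> S) : Prop :=
  forall x y, X x -> Y y ->
    [/\ limiting_subdiff (extend X (fun x' => f x' y)) x
          (mean_vector P (fun w => Gx x y (xi w))),
        limiting_subdiff (extend Y (fun y' => - f x y')) y
          (- mean_vector P (fun w => Gy x y (xi w))),
        ('E_P[fun w => (enorm (Gx x y (xi w)) ^+ 2)%R] <= (M1 ^+ 2)%:E)%E &
        ('E_P[fun w => (enorm (Gy x y (xi w)) ^+ 2)%R] <= (M2 ^+ 2)%:E)%E].

Definition sigma_of (dO dS : measure_display) (Omega : measurableType dO)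
    (S : measurableType dS) (V : Omega -> S) : set (set Omega) :=
  preimage_set_system setT V measurable.

Definition sigma_of_family (dO dS : measure_display) (Omega : measurableType dO)
    (S : measurableType dS) (xi : nat -> nat -> Omega -> S)
    (I : set (nat * nat)) : set (set Omega) :=
  <<s \bigcup_(i in I) sigma_of (xi i.1 i.2) >>.

Definition independent (R : realType) (dO : measure_display)
    (Omega : measurableType dO) (P : probability Omega R)
    (F G : set (set Omega)) : Prop :=
  forall A B, F A -> G B -> P (A `&` B) = (P A * P B)%E.

Definition fresh_samples (R : realType) (dO dS : measure_display)
    (Omega : measurableType dO) (S : measurableType dS)
    (P : probability Omega R) (K : nat) (xi : nat -> nat -> Omega -> S) : Prop :=
  forall k t, calls R K (k, t) ->
    independent P (sigma_of (xi k t))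
                  (sigma_of_family xi (calls_before R K k t)).

Definition uniform_index (R : realType) (dO : measure_display)
    (Omega : measurableType dO) (P : probability Omega R) (K : nat)
    (tau : Omega -> nat) : Prop :=
  (forall w, (1 <= tau w <= K)%N) /\
  (forall k, (1 <= k <= K)%N -> P (tau @^-1` [set k]) = (K%:R^-1)%:E).

(* F(e) = O(G(e) * ln(1/e)^p) for some p, as e -> 0+ *)
Definition soft_O (R : realType) (F G : R -> R) : Prop :=
  exists p : nat,
    (F : R -> R^o) =O_ (0^'+) ((fun e => G e * ln (e^-1) ^+ p) : R -> R^o).

(* Main.v *)
(** The argument is a Lyapunov descent for the outer loop.  Write [xh], [yh] for
    the saddle point of epoch [k], and
      A = rho |x_0 - xh|^2,  B = lam |y_0 - yh|^2   at the start of the epoch,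
      a, b                                          the same at its averages.
    By Fermat's rule the saddle point inherits quadratic growth directly from the
    subgradient inequalities, so the regret bound of the inner loop, taken at the
    comparator [(xh, yh)], which is determined by the past of the epoch, gives
      E (a + b) <= E A / 50 + E B / 100 + sigma / (k + 1),
      sigma = 2 M1^2 / rho + M2^2 / lam.
    The saddle value (a Moreau envelope of the primal function) decreases by at
    least [A - a], so [sum A <= eps0 + sum a]; and monotonicity of the saddle
    operator bounds the drift of [yh], so [B' <= 2 b + 4 A + 4 a] for the next
    epoch.  Hence [sum E A <= 2 eps0 + 2 sigma sum 1 / (k + 1)], and the harmonic
    sum is at most [ln (K + 1)].  Finally [gamma (x_0 - xh)] is a subgradient of
    the primal function at [xh]. *)

(* No measurability is assumed of the iterates or of the saddle points, which are given only by
   their variational properties. Both solve strongly convex (concave) problems, so they are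
   Lipschitz functions of their data; this yields measurability and square integrability along the
   run.

   Conditional expectations are never formed. [Omega] is equipped with the sigma-algebra generated
   by the calls made so far; the identity into that space is a random variable independent of the
   next sample, and Fubini's theorem for the product law does the conditioning.

   Progress is measured by distances to a saddle point known at the start of the epoch rather than
   by the duality gap of the averages: the best responses in that gap depend on the samples of the
   epoch, and the oracle noise would not average out against them.

   The inverse step sizes weigh the initial distances by multiples of k + 1. Since T_k is also
   proportional to k + 1, averaging turns these weights into the fixed factors 1/50 and 1/100. *)
Require Import Defs.
From HB Require Import structures.
From mathcomp Require Import all_boot all_order all_algebra.
From mathcomp Require Import all_classical all_reals all_analysis.
From mathcomp Require Import measurable_realfun.
From mathcomp Require Import ring lra.

Set Implicit Arguments.
Unset Strict Implicit.
Unset Printing Implicit Defensive.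

Import Order.TTheory GRing.Theory Num.Theory.
Import numFieldNormedType.Exports.

Local Open Scope classical_set_scope.
Local Open Scope ring_scope.

(** * Euclidean norm and subdifferentials *)

Section Euclidean.
Variables (R : realType) (d : nat).
Implicit Types (u v w : 'rV[R]_d) (a : R).

Lemma dotC u v : dot u v = dot v u.
Proof. by apply: eq_bigr => i _; rewrite mulrC. Qed.

Lemma dotDl u v w : dot (u + v) w = dot u w + dot v w.
Proof. by rewrite -big_split; apply: eq_bigr => i _; rewrite !mxE mulrDl. Qed.

Lemma dotZl a u v : dot (a *: u) v = a * dot u v.
Proof. by rewrite mulr_sumr; apply: eq_bigr => i _; rewrite !mxE mulrA. Qed.

Lemma dotNl u v : dot (- u) v = - dot u v.
Proof. by rewrite -scaleN1r dotZl mulN1r. Qed.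

Lemma dotDr u v w : dot u (v + w) = dot u v + dot u w.
Proof. by rewrite dotC dotDl !(dotC u). Qed.

Lemma dotZr a u v : dot u (a *: v) = a * dot u v.
Proof. by rewrite dotC dotZl (dotC u). Qed.

Lemma dotNr u v : dot u (- v) = - dot u v.
Proof. by rewrite dotC dotNl (dotC u). Qed.

Lemma dot0l u : dot 0 u = 0.
Proof. by rewrite -(scale0r 0) dotZl mul0r. Qed.

Lemma dot0r u : dot u 0 = 0.
Proof. by rewrite dotC dot0l. Qed.

Lemma enorm0 : enorm (0 : 'rV[R]_d) = 0.
Proof. by rewrite /enorm dot0l sqrtr0. Qed.

Definition dotE := (dotDl, dotDr, dotNl, dotNr, dotZl, dotZr).

Lemma dot_ge0 u : 0 <= dot u u.
Proof. by apply: sumr_ge0 => i _; rewrite -expr2 sqr_ge0. Qed.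

Lemma sqr_enorm u : enorm u ^+ 2 = dot u u.
Proof. by rewrite sqr_sqrtr // dot_ge0. Qed.

Lemma enorm_ge0 u : 0 <= enorm u.
Proof. exact: sqrtr_ge0. Qed.

Lemma sqr_coord_le u i : u 0 i ^+ 2 <= enorm u ^+ 2.
Proof.
rewrite sqr_enorm /dot (bigD1 i) //= -expr2 lerDl.
by apply: sumr_ge0 => j _; rewrite -expr2 sqr_ge0.
Qed.

Lemma sqr_enorm_le u : enorm u ^+ 2 <= d%:R * `|u| ^+ 2.
Proof.
rewrite sqr_enorm mulr_natl -[leRHS](_ : \sum_(i < d) `|u| ^+ 2 = _); last first.
  by rewrite sumr_const card_ord.
apply: ler_sum => i _; rewrite -expr2 -real_normK ?num_real //.
rewrite ler_sqr ?nnegrE //; rewrite [leRHS]/Num.norm /= mx_normrE.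
exact: (le_bigmax _ (fun ij : 'I_1 * 'I_d => `|u ij.1 ij.2|) (0, i)).
Qed.

Lemma young (c : R) u v : 0 < c ->
  2 * dot u v <= c * enorm u ^+ 2 + c^-1 * enorm v ^+ 2.
Proof.
move=> c0; have := dot_ge0 (c *: u - v).
rewrite !sqr_enorm !dotE (dotC v u) => h.
rewrite -(ler_pM2l c0) mulrDr mulVKf ?gt_eqF //; lra.
Qed.

Lemma sqr_enormD_le u v :
  enorm (u + v) ^+ 2 <= 2 * enorm u ^+ 2 + 2 * enorm v ^+ 2.
Proof.
have := dot_ge0 (u - v); rewrite !sqr_enorm !dotE (dotC v u); lra.
Qed.

Lemma sqr_enormB_le u v :
  enorm (u - v) ^+ 2 <= 2 * enorm u ^+ 2 + 2 * enorm v ^+ 2.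
Proof.
have := dot_ge0 (u + v); rewrite !sqr_enorm !dotE (dotC v u); lra.
Qed.

Lemma enormB_sym u v : enorm (u - v) ^+ 2 = enorm (v - u) ^+ 2.
Proof. by rewrite !sqr_enorm !dotE (dotC v u); lra. Qed.

End Euclidean.

Section Subdifferential.
Variables (R : realType) (d : nat).
Implicit Types (h : 'rV[R]_d -> \bar R) (x v p z : 'rV[R]_d).

(** The quadratic error divided by |z - x| is kappa |z - x|, which tends to 0; so the lower limit of
    the difference quotient is nonnegative. *)
Lemma frechet_subdiff_quad h x v (c kappa : R) : 0 <= kappa ->
  h x = c%:E ->
  (forall z, (c + dot v (z - x) - kappa * enorm (z - x) ^+ 2)%:E <= h z)%E ->
  frechet_subdiff h x v.
Proof.
move=> k0 hx hz; split; first by rewrite hx.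
rewrite limf_einfE; apply/lee_addgt0Pr => e e0.
pose r := e / (kappa + 1) / (d%:R + 1).
have kp : 0 < kappa + 1 by rewrite ltr_wpDl.
have dp : 0 < d%:R + 1 :> R by rewrite ltr_wpDl.
have r0 : 0 < r by rewrite !divr_gt0.
pose V := [set z | kappa * enorm (z - x) <= e].
have VF : x^' V.
  rewrite /dnbhs /within /=; apply/nbhs_ballP; exists r => //= z; rewrite -ball_normE /= => zr _.
  rewrite /V /=.
  have le1 : enorm (z - x) <= (d%:R + 1) * r.
    have dr0 : 0 <= (d%:R + 1) * r by rewrite mulr_ge0 // ltW.
    rewrite -ler_sqr ?nnegrE ?enorm_ge0 //.
    apply: le_trans; first exact: sqr_enorm_le.
    rewrite exprMn ler_pM ?ler0n ?sqr_ge0 //.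
      have : 0 <= (d%:R : R) by []; nra.
    rewrite distrC in zr; rewrite ler_sqr ?nnegrE ?normr_ge0 //; exact: ltW.
  have -> : e = (kappa + 1) * ((d%:R + 1) * r).
    by rewrite /r; field; rewrite !gt_eqF.
  apply: ler_pM => //; first exact: enorm_ge0.
  by rewrite lerDl.
have := @ereal_sup_ubound _ [set ereal_inf ((fun z => (h z - h x - (dot v (z - x))%:E)
                              * ((enorm (z - x))^-1)%:E)%E @` V) | V in x^'].
move=> /(_ (ereal_inf ((fun z => (h z - h x - (dot v (z - x))%:E)
                              * ((enorm (z - x))^-1)%:E)%E @` V))).
move=> /(_ (ex_intro2 _ _ V VF erefl)) ub.
apply: (@le_trans _ _ ((- e)%:E + e%:E)%E); first by rewrite -EFinD addNr.
rewrite leeD2r //; apply: le_trans ub.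
apply: le_ereal_inf_tmp => _ [z Vz <-].
have ez : 0 <= (enorm (z - x))^-1 by rewrite invr_ge0 enorm_ge0.
have H : ((- (kappa * enorm (z - x) ^+ 2))%:E <= h z - h x - (dot v (z - x))%:E)%E.
  have := hz z; rewrite hx; case: (h z) => [s| |] //=.
  - by rewrite -!EFinB !lee_fin; lra.
  - by move=> _; rewrite leey.
apply: (@le_trans _ _ ((- (kappa * enorm (z - x) ^+ 2))%:E * ((enorm (z - x))^-1)%:E)%E); last first.
  by apply: lee_wpmul2r; rewrite ?lee_fin.
rewrite -EFinM lee_fin; move: Vz; rewrite /V /=.
(* [V] contains [x] itself; there the quotient is harmless because 0^-1 = 0. *)
have [->|ne0] := eqVneq (enorm (z - x)) 0; first by rewrite invr0 mulr0 => _; lra.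
by rewrite mulNr -mulrA expr2 mulfK // lerN2.
Qed.

Lemma frechet_sub_limiting h x v :
  frechet_subdiff h x v -> limiting_subdiff h x v.
Proof.
move=> fv; split; first by case: fv.
by exists (fun=> x), (fun=> v); split => //; exact: cvg_cst.
Qed.

(* Fermat's rule for [h + kappa |. - p|^2]. *)
Lemma limiting_subdiff_prox h p x (c kappa : R) : 0 <= kappa ->
  h x = c%:E ->
  (forall z, (c + kappa * enorm (x - p) ^+ 2)%:E <=
             h z + (kappa * enorm (z - p) ^+ 2)%:E)%E ->
  limiting_subdiff h x (- (2 * kappa) *: (x - p)).
Proof.
move=> k0 hx hz; apply: frechet_sub_limiting; apply: (frechet_subdiff_quad k0 hx).
move=> z; have := hz z; case: (h z) => [s| |] //=; last by move=> _; rewrite leey.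
rewrite -EFinD !lee_fin !sqr_enorm !dotE (dotC z x) (dotC p x) (dotC z p); lra.
Qed.

End Subdifferential.

(** * Saddle points and proximal steps *)

Section Saddle.
Variables (R : realType) (d n : nat) (X : set 'rV[R]_d) (Y : set 'rV[R]_n).
Variables (f : 'rV[R]_d -> 'rV[R]_n -> R) (rho lam : R).
Hypotheses (rho_gt0 : 0 < rho) (lam_gt0 : 0 < lam).
Hypothesis f_wcvx : forall y, Y y -> weakly_convex rho X (fun x => f x y).
Hypothesis f_sccv : forall x, X x -> strongly_concave lam Y (fun y => f x y).

(** The weight [rho] is gamma / 2 for gamma = 2 rho, so the regularized function is rho-strongly
    convex in [u]. *)
Definition prox_saddle p :=
  is_saddle X Y (fun u v => f u v + rho * enorm (u - p) ^+ 2).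

Lemma prox_saddle_growth p xh yh x y : prox_saddle p xh yh -> X x -> Y y ->
  rho / 2 * enorm (x - xh) ^+ 2 + lam / 2 * enorm (y - yh) ^+ 2 <=
  (f x yh + rho * enorm (x - p) ^+ 2) - (f xh y + rho * enorm (xh - p) ^+ 2).
Proof.
move=> [Xxh Yyh sad] Xx Yy.
(* Fermat's rule gives the subgradient -2 rho (xh - p). Its linear term cancels that of rho |x -
   p|^2 expanded around [xh], and weak convexity uses up only half of the remaining rho |x -
   xh|^2. *)
have gx : rho / 2 * enorm (x - xh) ^+ 2 <=
    f x yh + rho * enorm (x - p) ^+ 2 - (f xh yh + rho * enorm (xh - p) ^+ 2).
  have xh_in : extend X (f ^~ yh) xh = (f xh yh)%:E by rewrite /extend mem_set.
  have Hp : (forall z, ((f xh yh + rho * enorm (xh - p) ^+ 2)%:E <=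
      extend X (f^~ yh) z + (rho * enorm (z - p) ^+ 2)%:E)%E).
    move=> z; rewrite /extend; case: ifPn => [/set_mem Xz|_]; last by rewrite addye // leey.
    by rewrite -EFinD lee_fin; case: (sad z yh Xz Yyh).
  have := f_wcvx Yyh Xx Xxh (limiting_subdiff_prox (ltW rho_gt0) xh_in Hp).
  rewrite !sqr_enorm !dotE (dotC p x) (dotC p xh) (dotC x xh); lra.
suff : lam / 2 * enorm (y - yh) ^+ 2 <= f xh yh - f xh y by lra.
have yh_in : extend Y (fun y => - f xh y) yh = (- f xh yh)%:E.
  by rewrite /extend mem_set.
(* With kappa = 0 Fermat's rule yields the subgradient 0 at the maximizer [yh]. *)
have := f_sccv Xxh Yy Yyh (limiting_subdiff_prox (p := yh) (lexx 0) yh_in _).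
rewrite mulr0 oppr0 scale0r dot0l add0r => H; apply: le_trans (H _) _; last by lra.
move=> z; rewrite !mul0r addr0 adde0 /extend; case: ifPn => [/set_mem Yz|_].
  by rewrite lee_fin lerN2; have [] := sad xh z Xxh Yz; rewrite lerD2r.
by rewrite leey.
Qed.

(** Apply the growth of each saddle point at the other one: the values of [f] at the mixed points
    (xh, yh') and (xh', yh) cancel, and the prox terms polarize to the inner product. *)
Lemma prox_saddle_monotone p p' xh yh xh' yh' :
  prox_saddle p xh yh -> prox_saddle p' xh' yh' ->
  rho * enorm (xh - xh') ^+ 2 + lam * enorm (yh - yh') ^+ 2 <=
  rho * (2 * dot (xh - xh') (p - p')).
Proof.
move=> s s'; have [Xxh Yyh _] := s; have [Xxh' Yyh' _] := s'.
have := prox_saddle_growth s Xxh' Yyh'; have := prox_saddle_growth s' Xxh Yyh.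
rewrite (enormB_sym xh' xh) (enormB_sym yh' yh) => h1 h2.
suff : rho * enorm (xh' - p) ^+ 2 - rho * enorm (xh - p) ^+ 2
  + rho * enorm (xh - p') ^+ 2 - rho * enorm (xh' - p') ^+ 2 =
  rho * (2 * dot (xh - xh') (p - p')) by lra.
rewrite !sqr_enorm !dotE (dotC p xh) (dotC p' xh) (dotC p xh') (dotC p' xh').
lra.
Qed.

(** Young's inequality with weight 1/2 moves half of |xh - xh'|^2 to the left. This bound makes [xh]
    a measurable function of the centre. *)
Lemma prox_saddle_lip_x p p' xh yh xh' yh' :
  prox_saddle p xh yh -> prox_saddle p' xh' yh' ->
  enorm (xh - xh') ^+ 2 <= 4 * enorm (p - p') ^+ 2.
Proof.
move=> s s'; have h := prox_saddle_monotone s s'.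
have h1 : 0 < (1 / 2 : R) by lra.
have := young (xh - xh') (p - p') h1.
have := sqr_ge0 (enorm (yh - yh')).
set a := enorm (xh - xh') ^+ 2 in h *; set b := enorm (yh - yh') ^+ 2 in h *.
have -> : (1 / 2 : R)^-1 = 2 by field.
move=> b0; rewrite -(ler_pM2l rho_gt0) => y; rewrite -(ler_pM2l rho_gt0).
have := mulr_ge0 (ltW lam_gt0) b0; lra.
Qed.

(** Here Young's inequality with weight 1 cancels the x-distance entirely. It serves twice: for the
    measurability of [yh] and for its drift from one epoch to the next. *)
Lemma prox_saddle_lip_y p p' xh yh xh' yh' :
  prox_saddle p xh yh -> prox_saddle p' xh' yh' ->
  lam * enorm (yh - yh') ^+ 2 <= rho * enorm (p - p') ^+ 2.
Proof.
move=> s s'; have h := prox_saddle_monotone s s'.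
have := young (xh - xh') (p - p') ltr01; rewrite invr1 -(ler_pM2l rho_gt0); lra.
Qed.

(** The weak-convexity loss rho/2 |x - xh|^2 at the iterate is exactly repaid by the growth at the
    saddle point, while strong concavity enters twice with lam/2, once at [y] and once at [yh]. *)
Lemma oracle_saddle_gap p xh yh x y gx gy : prox_saddle p xh yh -> X x -> Y y ->
  limiting_subdiff (extend X (f^~ y)) x gx ->
  limiting_subdiff (extend Y (fun y' => - f x y')) y (- gy) ->
  lam * enorm (y - yh) ^+ 2 + rho * enorm (xh - p) ^+ 2
    - rho * enorm (x - p) ^+ 2 <=
  dot gx (x - xh) + dot gy (yh - y).
Proof.
move=> s Xx Yy sx sy; have [Xxh Yyh _] := s.
have hx := f_wcvx Yy Xxh Xx sx; have hy := f_sccv Xx Yyh Yy sy.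
have := prox_saddle_growth s Xx Yy.
rewrite (enormB_sym x xh) (enormB_sym y yh).
move: hx hy; rewrite dotNl.
have -> : dot gx (xh - x) = - dot gx (x - xh) by rewrite -dotNr opprB.
lra.
Qed.

(** The primal function equals f xh yh at [xh] and is at least f z yh elsewhere, so [xh] minimizes
    it plus rho |. - p|^2, and Fermat's rule exhibits a subgradient. *)
Lemma dist0_primal p xh yh : prox_saddle p xh yh ->
  (dist0 (limiting_subdiff (primal X Y f) xh) <=
   (2 * rho * enorm (xh - p))%:E)%E.
Proof.
move=> [Xxh Yyh sad]; apply: ge_ereal_inf.
exists (enorm (- (2 * rho) *: (xh - p)))%:E.
  exists (- (2 * rho) *: (xh - p)) => //.
  apply: (@limiting_subdiff_prox _ _ _ _ _ (f xh yh)) => [||z].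
  - exact: ltW.
  - rewrite /primal mem_set //; apply/eqP; rewrite eq_le; apply/andP; split.
      apply: ge_ereal_sup => _ [y Yy <-]; rewrite lee_fin.
      by have [] := sad xh y Xxh Yy; rewrite lerD2r.
    by apply: ereal_sup_ubound; exists yh.
  - rewrite /primal; case: ifPn => [/set_mem Xz|_]; last by rewrite addye // leey.
    apply: (@le_trans _ _ ((f z yh)%:E + (rho * enorm (z - p) ^+ 2)%:E)%E).
      by rewrite -EFinD lee_fin; have [] := sad z yh Xz Yyh.
    by rewrite leeD2r //; apply: ereal_sup_ubound; exists yh.
rewrite lee_fin -ler_sqr ?nnegrE ?enorm_ge0 //; last first.
  by rewrite !mulr_ge0 ?enorm_ge0 // ltW.
by rewrite exprMn !sqr_enorm dotZl dotZr; lra.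
Qed.

Lemma gap_le (e : R) x0 y0 x y : (gap X Y f x0 y0 <= e%:E)%E ->
  X x -> Y y -> f x0 y - f x y0 <= e.
Proof.
move=> g Xx Yy; rewrite -lee_fin; apply: le_trans g.
rewrite EFinB /gap leeD //; first by apply: ereal_sup_ubound; exists y.
by rewrite leeN2; apply: ereal_inf_lbound; exists x.
Qed.

(** The prox term vanishes at its own centre [x0], so the growth at (x0, y0) is bounded by the gap
    of [f] alone. *)
Lemma prox_saddle_init_gap (e : R) x0 y0 xh yh :
  X x0 -> Y y0 -> (gap X Y f x0 y0 <= e%:E)%E -> prox_saddle x0 xh yh ->
  lam * enorm (y0 - yh) ^+ 2 <= 2 * e.
Proof.
move=> Xx0 Yy0 g s; have := prox_saddle_growth s Xx0 Yy0; have [Xxh Yyh _] := s.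
have := gap_le g Xxh Yyh; rewrite subrr enorm0.
have := mulr_ge0 (ltW rho_gt0) (sqr_ge0 (enorm (x0 - xh))).
have := mulr_ge0 (ltW rho_gt0) (sqr_ge0 (enorm (xh - x0))).
rewrite expr0n /= mulr0; lra.
Qed.

(** Pass through the mixed point (xh, yh'): [xh'] minimizes the new function against yh', and [yh]
    maximizes f xh. *)
Lemma prox_saddle_value_le p p' xh yh xh' yh' :
  prox_saddle p xh yh -> prox_saddle p' xh' yh' ->
  f xh' yh' + rho * enorm (xh' - p') ^+ 2 <= f xh yh + rho * enorm (xh - p') ^+ 2.
Proof.
move=> [Xxh Yyh s] [Xxh' Yyh' s'].
have [_ h] := s' _ _ Xxh Yyh'; apply: le_trans h _.
by rewrite lerD2r; have [+ _] := s _ _ Xxh Yyh'; rewrite lerD2r.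
Qed.

End Saddle.

Section Argmin.
Variables (R : realType) (d : nat) (X : set 'rV[R]_d).
Hypothesis convexX : convex_set X.

Lemma convex_setP x y (s : R) : X x -> X y -> 0 <= s <= 1 ->
  X (s *: x + (1 - s) *: y).
Proof.
move=> Xx Xy /andP[s0 s1].
by have := convexX (Itv01 s0 s1) (mem_set Xx) (mem_set Xy); rewrite inE.
Qed.

Lemma convex_set_mean (u : nat -> 'rV[R]_d) (N : nat) : (0 < N)%N ->
  (forall t, (t < N)%N -> X (u t)) -> X (N%:R^-1 *: \sum_(t < N) u t).
Proof.
case: N => // N _; elim: N => [|N IH] Xu.
  by rewrite big_ord_recl big_ord0 invr1 scale1r addr0; exact: Xu.
rewrite big_ord_recr /=.
have N1 : (N.+1%:R : R) != 0 by rewrite pnatr_eq0.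
have N2 : (N.+2%:R : R) != 0 by rewrite pnatr_eq0.
have -> : N.+2%:R^-1 *: (\sum_(i < N.+1) u i + u N.+1) =
   (N.+1%:R / N.+2%:R) *: (N.+1%:R^-1 *: \sum_(i < N.+1) u i)
   + (1 - N.+1%:R / N.+2%:R) *: u N.+1.
  rewrite scalerDr scalerA mulrAC divff // mul1r; congr (_ + _ *: _).
  by rewrite -[X in X - _](divff N2) -mulrBl -natrB // subSnn mul1r.
apply: convex_setP.
- by apply: IH => t tN; apply: Xu; exact: ltnW.
- exact: Xu.
- by rewrite divr_ge0 //= ler_pdivrMr ?ltr0Sn // mul1r ler_nat.
Qed.

(** The equality case of strong convexity: it holds for c |z|^2 plus an affine function. *)
Definition quadratic (c : R) (psi : 'rV[R]_d -> R) := forall a b s,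
  psi (s *: a + (1 - s) *: b) =
  s * psi a + (1 - s) * psi b - c * (s * (1 - s)) * enorm (a - b) ^+ 2.

(** Compare [z] with the points s x + (1 - s) z of the segment, divide by s and let s tend to 0. *)
Lemma argmin_quadratic c psi z x : quadratic c psi -> is_argmin X psi z ->
  X x -> psi z + c * enorm (x - z) ^+ 2 <= psi x.
Proof.
move=> q [Xz zmin] Xx; set e2 := enorm (x - z) ^+ 2.
have H (s : R) : 0 < s -> s <= 1 -> psi z + c * (1 - s) * e2 <= psi x.
  move=> s0 s1; have s01 : 0 <= s <= 1 by rewrite ltW.
  have := zmin _ (convex_setP Xx Xz s01); rewrite q -/e2 => h.
  rewrite -(ler_pM2l s0); lra.
apply/ler_addgt0Pr => e e0.
pose s := Num.min 1 (e / (`|c * e2| + 1)).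
have ce0 : 0 < `|c * e2| + 1 by rewrite ltr_wpDl.
have s0 : 0 < s by rewrite lt_min ltr01 divr_gt0.
have s1 : s <= 1 by rewrite ge_min lexx.
have := H s s0 s1; suff : c * s * e2 <= e by lra.
rewrite mulrAC; apply: (@le_trans _ _ ((`|c * e2| + 1) * (e / (`|c * e2| + 1)))).
  apply: (@le_trans _ _ ((`|c * e2| + 1) * s)).
    by rewrite ler_pM2r //; have := ler_norm (c * e2); lra.
  by rewrite ler_pM2l // ge_min lexx orbT.
by rewrite mulrC divfK // gt_eqF.
Qed.

Lemma quadratic_prox (g p q : 'rV[R]_d) (alpha beta : R) :
  quadratic (alpha + beta) (fun z => dot z g + alpha * enorm (z - p) ^+ 2
                                     + beta * enorm (z - q) ^+ 2).
Proof.
move=> a b s; rewrite !sqr_enorm !dotE.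
rewrite (dotC p a) (dotC p b) (dotC q a) (dotC q b) (dotC b a); ring.
Qed.

(** Sum the growth of each minimizer at the other. The two objectives differ by a linear function,
    up to constants, with slope twice the vector on the right; the bound gives the measurability of
    iterates known only as minimizers. *)
Lemma argmin_prox_lip (g p q g' p' q' z z' : 'rV[R]_d) (alpha beta : R) :
  0 < alpha -> 0 <= beta ->
  is_argmin X (fun z => dot z g + alpha * enorm (z - p) ^+ 2
                        + beta * enorm (z - q) ^+ 2) z ->
  is_argmin X (fun z => dot z g' + alpha * enorm (z - p') ^+ 2
                        + beta * enorm (z - q') ^+ 2) z' ->
  (alpha + beta) ^+ 2 * enorm (z - z') ^+ 2 <=
  enorm (2^-1 *: (g' - g) + alpha *: (p - p') + beta *: (q - q')) ^+ 2.
Proof.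
move=> a0 b0 m m'.
have := argmin_quadratic (@quadratic_prox g p q alpha beta) m (proj1 m').
have := argmin_quadratic (@quadratic_prox g' p' q' alpha beta) m' (proj1 m).
rewrite (enormB_sym z' z) /=; set e2 := enorm (z - z') ^+ 2 => h1 h2.
set w := _ + _ *: (q - q').
have ab : 0 < alpha + beta by rewrite ltr_pwDl.
have h : (alpha + beta) * e2 <= dot (z - z') w.
  move: h1 h2; rewrite /w !sqr_enorm !dotE.
  rewrite (dotC p z) (dotC q z) (dotC p z') (dotC q z').
  rewrite (dotC p' z) (dotC q' z) (dotC p' z') (dotC q' z').
  have -> : 2^-1 = 1 / 2 :> R by rewrite mul1r.
  lra.
have := young (z - z') w ab; rewrite -/e2 => y.
have : (alpha + beta) * e2 <= (alpha + beta)^-1 * enorm w ^+ 2 by lra.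
by rewrite -(ler_pM2l ab) mulVKf ?gt_eqF // mulrA.
Qed.

(** The three-point inequality at the comparator [x]. Replacing [z] by [p] in the linear term costs
    eta/2 |g|^2 by Young's inequality, whose other term is absorbed by the prox term |z - p|^2. *)
Lemma prox_step (g p q z x : 'rV[R]_d) (eta beta : R) : 0 < eta -> 0 <= beta ->
  is_argmin X (fun z => dot z g + (2 * eta)^-1 * enorm (z - p) ^+ 2
                        + beta * enorm (z - q) ^+ 2) z -> X x ->
  dot g (p - x) <= (2 * eta)^-1 * enorm (x - p) ^+ 2
    - ((2 * eta)^-1 + beta) * enorm (x - z) ^+ 2
    + beta * enorm (x - q) ^+ 2 - beta * enorm (z - q) ^+ 2
    + eta / 2 * enorm g ^+ 2.
Proof.
move=> e0 b0 m Xx.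
have := argmin_quadratic (@quadratic_prox g p q _ beta) m Xx => /=.
have ei0 : 0 < eta^-1 by rewrite invr_gt0.
have := young (p - z) g ei0; rewrite invrK (enormB_sym p z) (_ : (2 * eta)^-1 = eta^-1 / 2); last first.
  by rewrite invfM mulrC.
rewrite !dotE (dotC z g) (dotC x g) (dotC p g); lra.
Qed.

(** The previous inequality at the comparator [p]; it keeps the iterates square-integrable. *)
Lemma prox_step_sqr (g p q z : 'rV[R]_d) (eta beta : R) :
  0 < eta -> 0 <= beta -> X p ->
  is_argmin X (fun z => dot z g + (2 * eta)^-1 * enorm (z - p) ^+ 2
                        + beta * enorm (z - q) ^+ 2) z ->
  enorm (z - p) ^+ 2 <= eta ^+ 2 * enorm g ^+ 2 + 2 * eta * beta * enorm (p - q) ^+ 2.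
Proof.
move=> e0 b0 Xp m; have := prox_step e0 b0 m Xp.
rewrite subrr dot0r enorm0 (enormB_sym p z) expr0n /= mulr0 add0r.
have := sqr_ge0 (enorm (z - q)); set A := enorm (z - q) ^+ 2.
set B := enorm (z - p) ^+ 2; set C := enorm (p - q) ^+ 2; set G := enorm g ^+ 2.
have : 0 <= B by rewrite sqr_ge0.
move=> B0 A0 h.
have : (2 * eta) * (((2 * eta)^-1 + beta) * B) <= (2 * eta) * (beta * C + eta / 2 * G).
  by rewrite ler_pM2l ?mulr_gt0 //; have := mulr_ge0 b0 A0; lra.
rewrite mulrA mulrDr divff; last by rewrite gt_eqF // mulr_gt0.
move=> h'.
have : 0 <= eta * beta * B by exact: mulr_ge0 (mulr_ge0 (ltW e0) b0) B0.
lra.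
Qed.

End Argmin.

(** * Measurability of vector-valued functions *)

Definition vmeasurable (R : realType) (d : nat) (dT : measure_display)
    (T : measurableType dT) (u : T -> 'rV[R]_d) :=
  forall i, measurable_fun setT (fun w => u w 0 i).

Section VectorMeasurability.
Variables (R : realType) (dT : measure_display) (T : measurableType dT).

Lemma vmeasurable_ball d (u : T -> 'rV[R]_d) (q : 'rV[R]_d) (r : R) :
  vmeasurable u -> measurable (u @^-1` ball q r).
Proof.
move=> mu; have [r0|r0] := ltP 0 r; last first.
  rewrite (_ : _ @^-1` _ = set0) //; apply/seteqP; split => // w.
  by rewrite /preimage -ball_normE /= => /lt_le_trans/(_ r0); rewrite normr_lt0.
rewrite (_ : _ @^-1` _ = \bigcap_(i in [set: 'I_d]) [set w | `|q 0 i - u w 0 i| < r]).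
  apply: fin_bigcap_measurable => // i _.
  rewrite -[X in measurable X]setTI.
  have : measurable_fun setT (fun w => `|q 0 i - u w 0 i|).
    by apply: measurableT_comp => //; apply: measurable_funB.
  move=> /(_ measurableT `]-oo, r[%classic (measurable_itv _)).
  by congr (measurable (_ `&` _)); apply/seteqP; split => w; rewrite /preimage /= in_itv.
apply/seteqP; split => w.
  rewrite /preimage -ball_normE /= => h i _ /=; apply: le_lt_trans h.
  rewrite [leRHS]/Num.norm /= mx_normrE.
  have := le_bigmax (0:R) (fun ij : 'I_1 * 'I_d => `|(q - u w) ij.1 ij.2|) (0, i).
  by rewrite /= !mxE.
move=> h; rewrite /preimage -ball_normE /= [ltLHS]/Num.norm /= mx_normrE.
apply/bigmax_ltP; split => // -[i j] _ /=.
by rewrite ord1 !mxE; apply: (h j).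
Qed.

(** An open set is the union of the balls with rational centre and radius that it contains, a
    countable family. *)
Lemma vmeasurable_open d (u : T -> 'rV[R]_d) (O : set 'rV[R]_d) :
  vmeasurable u -> open O -> measurable (u @^-1` O).
Proof.
move=> mu oO.
pose rv (q : 'rV[rat]_d) : 'rV[R]_d := \row_i ratr (q 0 i).
pose F (qr : 'rV[rat]_d * rat) : set T :=
  if `[< ball (rv qr.1) (ratr qr.2 : R) `<=` O >]
  then u @^-1` ball (rv qr.1) (ratr qr.2) else set0.
rewrite (_ : _ @^-1` _ = \bigcup_qr F qr).
  apply: countable_bigcupT_measurable => // qr; rewrite /F; case: ifP => // _.
  exact: vmeasurable_ball.
apply/seteqP; split => [w Ow|w [qr _]]; last first.
  by rewrite /F; case: ifPn => // /asboolP h; exact: h.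
have /nbhs_ballP [e /= e0 eO] : nbhs (u w) O by exact: open_nbhs_nbhs.
have /rat_in_itvoo [r] : (0 : R) < e / 2 by rewrite divr_gt0.
rewrite in_itv /= => /andP[r0 re].
have q_ex i : exists q : rat, `|u w 0 i - ratr q| < ratr r.
  have : u w 0 i - ratr r < u w 0 i + ratr r by lra.
  move=> /rat_in_itvoo [q]; rewrite in_itv /= => /andP[h1 h2].
  by exists q; rewrite ltr_norml; apply/andP; split; lra.
have [q hq] := choice q_ex.
have close : `|u w - rv (\row_i q i)| < ratr r :> R.
  rewrite [ltLHS]/Num.norm /= mx_normrE; apply/bigmax_ltP; split => // -[i j] _ /=.
  by rewrite ord1 !mxE; apply: hq.
exists (\row_i q i, r) => //; rewrite /F; case: ifPn => /=; last first.
  move=> /asboolP; case => z; rewrite -ball_normE /= => hz; apply: eO.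
  rewrite -ball_normE /=.
  rewrite (le_lt_trans (ler_distD (rv (\row_i q i)) _ _)) //; lra.
by move=> _; rewrite /preimage -ball_normE /= distrC.
Qed.

Lemma vmeasurable_closed d (u : T -> 'rV[R]_d) (C : set 'rV[R]_d) :
  vmeasurable u -> closed C -> measurable (u @^-1` C).
Proof.
move=> mu cC; rewrite -[_ @^-1` _]setCK preimage_setC; apply: measurableC.
by apply: vmeasurable_open => //; exact: closed_openC.
Qed.

(* No formula for [phi] in terms of [u] is needed: continuous dependence on
   [u] suffices. *)
Lemma measurable_fun_dep d (u : T -> 'rV[R]_d) (phi : T -> R) :
  vmeasurable u ->
  (forall w (e : R), 0 < e -> exists2 del : R, 0 < del &
    forall w', `|u w - u w'| < del -> `|phi w - phi w'| < e) ->
  measurable_fun setT phi.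
Proof.
move=> mu dep; apply: (measurability _ (RGenOInfty.measurableE R)).
move=> _ [_ [a ->] <-]; rewrite setTI.
have hdel w : exists del : R, a < phi w ->
    0 < del /\ forall w', `|u w - u w'| < del -> a < phi w'.
  have [aw|_] := ltP a (phi w); last by exists 0.
  have [|del del0 h] := dep w (phi w - a); first by rewrite subr_gt0.
  exists del => _; split => // w' /h; rewrite ltr_norml => /andP[_]; lra.
have [del hd] := choice hdel.
(* The union of balls may be uncountable, but it is open, and preimages of open sets under [u] are
   measurable. *)
rewrite (_ : _ @^-1` _ =
   u @^-1` \bigcup_(w in [set w | a < phi w]) ball (u w) (del w)).
  apply: vmeasurable_open => //; apply: bigcup_open => w /= aw.
  exact: ball_open.
apply/seteqP; split => w /=; rewrite ?in_itv ?andbT /=.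
  by move=> aw; exists w => //; exact: ballxx (hd w aw).1.
move=> [w' aw']; rewrite -ball_normE /= => h.
by apply: (hd w' aw').2.
Qed.

Lemma vmeasurable_cst d (c : 'rV[R]_d) : vmeasurable (fun _ : T => c).
Proof. by move=> i; exact: measurable_cst. Qed.

Lemma vmeasurableD d (u v : T -> 'rV[R]_d) :
  vmeasurable u -> vmeasurable v -> vmeasurable (fun w => u w + v w).
Proof.
move=> mu mv i; under eq_fun do rewrite mxE.
by apply: measurable_funD; [exact: mu|exact: mv].
Qed.

Lemma vmeasurableZ d (c : R) (u : T -> 'rV[R]_d) :
  vmeasurable u -> vmeasurable (fun w => c *: u w).
Proof.
move=> mu i; under eq_fun do rewrite mxE.
by apply: measurable_funM => //; exact: mu.
Qed.

Lemma vmeasurableB d (u v : T -> 'rV[R]_d) :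
  vmeasurable u -> vmeasurable v -> vmeasurable (fun w => u w - v w).
Proof.
move=> mu mv; apply: vmeasurableD => //.
by under eq_fun do rewrite -scaleN1r; exact: vmeasurableZ.
Qed.

Lemma vmeasurable_sum d (N : nat) (u : nat -> T -> 'rV[R]_d) :
  (forall t, (t < N)%N -> vmeasurable (u t)) ->
  vmeasurable (fun w => \sum_(t < N) u t w).
Proof.
elim: N => [|N IH] mu.
  by under eq_fun do rewrite big_ord0; exact: vmeasurable_cst.
under eq_fun do rewrite big_ord_recr /=.
apply: vmeasurableD; last exact: mu.
by apply: IH => t tN; apply: mu; exact: ltnW.
Qed.

Lemma measurable_dot d (u v : T -> 'rV[R]_d) :
  vmeasurable u -> vmeasurable v -> measurable_fun setT (fun w => dot (u w) (v w)).
Proof.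
move=> mu mv; apply: measurable_sum => i.
by apply: measurable_funM; [exact: mu|exact: mv].
Qed.

Lemma measurable_sqr_enorm d (u : T -> 'rV[R]_d) :
  vmeasurable u -> measurable_fun setT (fun w => enorm (u w) ^+ 2).
Proof. by move=> mu; under eq_fun do rewrite sqr_enorm; exact: measurable_dot. Qed.

Lemma vmeasurable_dep d d' (u : T -> 'rV[R]_d) (z : T -> 'rV[R]_d') (C : R) :
  vmeasurable u ->
  (forall w w', enorm (z w - z w') ^+ 2 <= C * enorm (u w - u w') ^+ 2) ->
  vmeasurable z.
Proof.
move=> mu lip i; apply: (measurable_fun_dep mu) => w e e0.
pose L := (`|C| + 1) * (d%:R + 1).
have C0 : 0 < `|C| + 1 by rewrite ltr_wpDl.
have dp : 0 < d%:R + 1 :> R by rewrite ltr_wpDl.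
have L0 : 0 < L by rewrite mulr_gt0.
exists (Num.sqrt (e ^+ 2 / L)); first by rewrite sqrtr_gt0 divr_gt0 // exprn_gt0.
move=> w' h; rewrite -(@ltr_sqr _ `|_|) ?nnegrE ?(ltW e0) // real_normK ?num_real //.
have /le_lt_trans : (z w 0 i - z w' 0 i) ^+ 2 <= enorm (z w - z w') ^+ 2.
  by have := sqr_coord_le (z w - z w') i; rewrite !mxE.
apply; apply: (le_lt_trans (lip w w')).
have un := sqr_enorm_le (u w - u w').
have h2 : `|u w - u w'| ^+ 2 < e ^+ 2 / L.
  rewrite -ltr_sqr ?nnegrE ?sqrtr_ge0 ?normr_ge0 // sqr_sqrtr in h => //.
  by rewrite divr_ge0 ?sqr_ge0 // ltW.
have h3 : L * `|u w - u w'| ^+ 2 < e ^+ 2.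
  by rewrite mulrC -ltr_pdivlMr.
apply: le_lt_trans h3; rewrite /L -mulrA.
have e2 : 0 <= enorm (u w - u w') ^+ 2 by rewrite sqr_ge0.
apply: (@le_trans _ _ ((`|C| + 1) * enorm (u w - u w') ^+ 2)).
  by rewrite ler_wpM2r //; have := ler_norm C; lra.
rewrite ler_pM2l //; apply: (le_trans un).
by rewrite ler_wpM2r ?sqr_ge0 // lerDl.
Qed.

End VectorMeasurability.

(** * Square-integrable vectors and independence *)

Section SquareIntegrable.
Variables (R : realType) (dT : measure_display) (T : measurableType dT).
Variable P : probability T R.

Definition sqintegrable d (u : T -> 'rV[R]_d) :=
  vmeasurable u /\ P.-integrable setT (fun w => (enorm (u w) ^+ 2)%:E).

Lemma integrable_le (f g : T -> R) : measurable_fun setT f ->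
  (forall w, `|f w| <= g w) -> P.-integrable setT (EFin \o g) ->
  P.-integrable setT (EFin \o f).
Proof.
move=> mf fg ig; apply: (le_integrable measurableT _ _ ig) => /=.
  exact/measurable_EFinP.
by move=> w _; rewrite lee_fin (le_trans (fg w)) // ler_norm.
Qed.

Lemma integrable_lin (a b : R) (f g : T -> R) :
  P.-integrable setT (EFin \o f) -> P.-integrable setT (EFin \o g) ->
  P.-integrable setT (EFin \o (fun w => a * f w + b * g w)).
Proof.
move=> fi gi.
have -> : EFin \o (fun w => a * f w + b * g w) =
    ((fun w => a%:E * (EFin \o f) w) \+ (fun w => b%:E * (EFin \o g) w))%E.
  by apply/funext => w /=; rewrite EFinD !EFinM.
by apply: integrableD => //; apply: integrableZl.
Qed.

Lemma integrable_const (c : R) : P.-integrable setT (EFin \o (fun=> c)).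
Proof. exact: finite_measure_integrable_cst. Qed.

Lemma Rintegral_const (c : R) : \int[P]_w c = c.
Proof. by rewrite Rintegral_cst // [X in fine X]probability_setT mulr1. Qed.

Lemma Rintegral_lin (a b : R) (f g : T -> R) :
  P.-integrable setT (EFin \o f) -> P.-integrable setT (EFin \o g) ->
  \int[P]_w (a * f w + b * g w) = a * \int[P]_w f w + b * \int[P]_w g w.
Proof.
move=> fi gi; rewrite RintegralD //; last 2 first.
- have := integrable_lin a 0 fi fi; apply: eq_integrable => // w _ /=.
  by rewrite mul0r addr0.
- have := integrable_lin b 0 gi gi; apply: eq_integrable => // w _ /=.
  by rewrite mul0r addr0.
by rewrite !RintegralZl.
Qed.

Lemma ge0_integral_bounded (f : T -> R) (c : R) : measurable_fun setT f ->
  (forall w, 0 <= f w) -> (\int[P]_w (f w)%:E <= c%:E)%E ->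
  P.-integrable setT (EFin \o f) /\ \int[P]_w f w <= c.
Proof.
move=> mf f0 fc.
have fi : P.-integrable setT (EFin \o f).
  apply/integrableP; split; first exact/measurable_EFinP.
  rewrite (eq_integral (EFin \o f)); first exact: le_lt_trans fc (ltry _).
  by move=> w _; rewrite gee0_abs // lee_fin.
by split => //; rewrite -lee_fin /Rintegral fineK // integrable_fin_num.
Qed.

Lemma sqintegrable_le d d1 d2 (z : T -> 'rV[R]_d) (u : T -> 'rV[R]_d1)
    (v : T -> 'rV[R]_d2) (a b c : R) :
  vmeasurable z -> sqintegrable u -> sqintegrable v ->
  (forall w, enorm (z w) ^+ 2 <= a * enorm (u w) ^+ 2 + b * enorm (v w) ^+ 2 + c) ->
  sqintegrable z.
Proof.
move=> mz [_ iu] [_ iv] h; split => //.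
apply: (integrable_le (g := fun w => 1 * (a * enorm (u w) ^+ 2 + b * enorm (v w) ^+ 2) + c * 1)).
- exact: measurable_sqr_enorm.
- by move=> w; rewrite ger0_norm ?sqr_ge0 // mul1r mulr1.
- by apply: integrable_lin; [exact: integrable_lin|exact: integrable_const].
Qed.

Lemma sqintegrable_cst d (c : 'rV[R]_d) : sqintegrable (fun _ : T => c).
Proof.
by split; [exact: vmeasurable_cst|exact: (integrable_const (enorm c ^+ 2))].
Qed.

Lemma sqintegrableD d (u v : T -> 'rV[R]_d) :
  sqintegrable u -> sqintegrable v -> sqintegrable (fun w => u w + v w).
Proof.
move=> su sv; apply: (sqintegrable_le (a := 2) (b := 2) (c := 0) _ su sv).
  by apply: vmeasurableD; [case: su|case: sv].
by move=> w; rewrite addr0 sqr_enormD_le.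
Qed.

Lemma sqintegrableZ d (a : R) (u : T -> 'rV[R]_d) :
  sqintegrable u -> sqintegrable (fun w => a *: u w).
Proof.
move=> su; apply: (sqintegrable_le (a := a ^+ 2) (b := 0) (c := 0) _ su su).
  by apply: vmeasurableZ; case: su.
by move=> w; rewrite mul0r !addr0 !sqr_enorm dotZl dotZr mulrA.
Qed.

Lemma sqintegrableB d (u v : T -> 'rV[R]_d) :
  sqintegrable u -> sqintegrable v -> sqintegrable (fun w => u w - v w).
Proof.
move=> su sv; apply: sqintegrableD => //.
by under eq_fun do rewrite -scaleN1r; exact: sqintegrableZ.
Qed.

Lemma sqintegrable_sum d (N : nat) (u : nat -> T -> 'rV[R]_d) :
  (forall t, (t < N)%N -> sqintegrable (u t)) ->
  sqintegrable (fun w => \sum_(t < N) u t w).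
Proof.
elim: N => [|N IH] su.
  by under eq_fun do rewrite big_ord0; exact: sqintegrable_cst.
under eq_fun do rewrite big_ord_recr /=.
apply: sqintegrableD; last exact: su.
by apply: IH => t tN; apply: su; exact: ltnW.
Qed.

Lemma integrable_dot d (u v : T -> 'rV[R]_d) :
  sqintegrable u -> sqintegrable v ->
  P.-integrable setT (EFin \o (fun w => dot (u w) (v w))).
Proof.
move=> [mu iu] [mv iv].
apply: (integrable_le (g := fun w => 1 * enorm (u w) ^+ 2 + 1 * enorm (v w) ^+ 2)).
- exact: measurable_dot.
- move=> w; rewrite ler_norml; apply/andP; split.
    have := dot_ge0 (u w + v w); rewrite !sqr_enorm !dotE (dotC (v w)).
    by have := dot_ge0 (u w); have := dot_ge0 (v w); lra.
  have := dot_ge0 (u w - v w); rewrite !sqr_enorm !dotE (dotC (v w)).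
  by have := dot_ge0 (u w); have := dot_ge0 (v w); lra.
- exact: integrable_lin.
Qed.

Lemma integrable_coord d (u : T -> 'rV[R]_d) i :
  sqintegrable u -> P.-integrable setT (EFin \o (fun w => u w 0 i)).
Proof.
move=> [mu iu].
apply: (integrable_le (g := fun w => 1 * enorm (u w) ^+ 2 + 1 * 1)) => //.
- move=> w; rewrite !mul1r; apply: le_trans (_ : u w 0 i ^+ 2 + 1 <= _).
    rewrite -real_normK ?num_real //; have := sqr_ge0 (`|u w 0 i| - 1); nra.
  by rewrite lerD2r sqr_coord_le.
- by apply: integrable_lin => //; exact: integrable_const.
Qed.

Lemma Rintegral_sum N (F : nat -> T -> R) :
  (forall i, (i < N)%N -> P.-integrable setT (EFin \o F i)) ->
  P.-integrable setT (EFin \o (fun w => \sum_(i < N) F i w)) /\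
  \int[P]_w (\sum_(i < N) F i w) = \sum_(i < N) \int[P]_w F i w.
Proof.
elim: N => [|N IH] iF.
  under eq_fun do rewrite big_ord0; split; first exact: integrable_const.
  by rewrite big_ord0 Rintegral_cst // mul0r.
have [|i1 e1] := IH; first by move=> i iN; apply: iF; exact: ltnW.
have iN := iF N (ltnSn N); split.
  have := integrable_lin 1 1 i1 iN; apply: eq_integrable => // w _ /=.
  by rewrite big_ord_recr !mul1r.
rewrite big_ord_recr /= -e1 -RintegralD //.
by apply: eq_Rintegral => w _; rewrite big_ord_recr.
Qed.

Lemma Rintegral_dot_cst d (u : T -> 'rV[R]_d) (c : 'rV[R]_d) :
  sqintegrable u ->
  \int[P]_w dot (u w) c = dot (mean_vector P u) c.
Proof.
(* Coordinates are reached from natural numbers through [inord], which requires a positive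
   dimension. *)
case: d u c => [|d] u c su.
  under eq_Rintegral do rewrite /dot big_ord0.
  by rewrite /dot big_ord0 Rintegral_cst // mul0r.
have iF i : (i < d.+1)%N -> P.-integrable setT (EFin \o (fun w => u w 0 (inord i) * c 0 (inord i))).
  move=> _; have := integrable_lin (c 0 (inord i)) 0 (integrable_coord (inord i) su) (integrable_const 0).
  by apply: eq_integrable => // w _ /=; rewrite mulr0 addr0 mulrC.
have [_ e] := Rintegral_sum iF.
transitivity (\int[P]_w \sum_(i < d.+1) (u w 0 (inord i) * c 0 (inord i))).
  by apply: eq_Rintegral => w _; apply: eq_bigr => i _; rewrite inord_val.
rewrite e; apply: eq_bigr => i _; rewrite inord_val RintegralZr //; last first.
  exact: integrable_coord.
by rewrite mxE unlock.
Qed.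

End SquareIntegrable.

Section Independence.
Variables (R : realType) (dO dT dS : measure_display).
Variables (Omega : measurableType dO) (T : measurableType dT) (S : measurableType dS).
Variables (P : probability Omega R) (Z : {RV P >-> T}) (xi : {RV P >-> S}).
Hypothesis indep : forall A B, measurable A -> measurable B ->
  P (Z @^-1` A `&` xi @^-1` B) = (P (Z @^-1` A) * P (xi @^-1` B))%E.

Local Notation mu := (distribution P Z \x distribution P xi)%E.

Let pair_measurable : measurable_fun setT (fun w => (Z w, xi w)).
Proof. by apply: measurable_fun_pair. Qed.

Let joint : {RV P >-> (T * S)%type} := mfun_Sub (mem_set pair_measurable).

Let joint_law A : measurable A -> mu A = distribution P joint A.
Proof.
by move=> mA; apply: product_measure_unique => // B C mB mC; exact: indep.
Qed.

(** The joint law is the product of the marginals, so Tonelli's theorem applies. The inner integral,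
    over a fresh copy [w'] of the outcome, plays the role of the conditional expectation given
    [Z]. *)
Lemma ge0_integral_indep (phi : T * S -> \bar R) :
  measurable_fun setT phi -> (forall z, 0 <= phi z)%E ->
  (\int[P]_w phi (Z w, xi w) = \int[P]_w \int[P]_w' phi (Z w, xi w'))%E.
Proof.
move=> mphi phi0.
rewrite -(@ge0_integral_distribution _ _ _ _ _ P joint phi) //.
rewrite -(eq_measure_integral _ (fun A mA _ => joint_law mA)).
rewrite fubini_tonelli1 // /fubini_F.
rewrite ge0_integral_distribution //=; last 2 first.
- exact: measurable_fun_fubini_tonelli_F.
- by move=> y; apply: integral_ge0.
apply: eq_integral => w _; rewrite ge0_integral_distribution //.
exact: measurable_fun_pair2.
Qed.

(** Sections are taken integrable for every outcome, not just almost every one, so that the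
    real-valued inner integral agrees pointwise with [fubini_F]. *)
Lemma integral_indep (phi : T * S -> R) :
  measurable_fun setT phi ->
  P.-integrable setT (EFin \o (fun w => phi (Z w, xi w))) ->
  (forall w, P.-integrable setT (EFin \o (fun w' => phi (Z w, xi w')))) ->
  P.-integrable setT (EFin \o (fun w => \int[P]_w' phi (Z w, xi w'))) /\
  \int[P]_w phi (Z w, xi w) = \int[P]_w \int[P]_w' phi (Z w, xi w').
Proof.
move=> mphi iphi isec.
have mE : measurable_fun setT (EFin \o phi) by exact/measurable_EFinP.
have i2 : mu.-integrable setT (EFin \o phi).
  apply/integrableP; split => //.
  rewrite (eq_measure_integral _ (fun A mA _ => joint_law mA)).
  rewrite ge0_integral_distribution //; last exact: measurableT_comp.
  by have /integrableP[] := iphi.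
have FE w : fubini_F (distribution P xi) (EFin \o phi) (Z w) =
    (\int[P]_w' phi (Z w, xi w'))%:E.
  rewrite /fubini_F integral_distribution //=; last 2 first.
  - exact: (measurable_fun_pair2 (Z w) mE).
  - exact: isec.
  rewrite /Rintegral fineK //; exact: integrable_fin_num (isec w).
have iF := integrable_fubini_F i2.
have iFZ : P.-integrable setT (EFin \o (fun w => \int[P]_w' phi (Z w, xi w'))).
  apply/integrableP; split.
    apply: (eq_measurable_fun (fubini_F (distribution P xi) (EFin \o phi) \o Z)).
      by move=> w _ /=; rewrite FE.
    by apply: measurableT_comp => //; exact: measurable_int iF.
  have /integrableP[mF] := iF.
  rewrite ge0_integral_distribution //; last exact: measurableT_comp.
  by under eq_integral do rewrite /= FE.
split => //; rewrite /Rintegral; congr fine.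
transitivity (\int[P]_w (fubini_F (distribution P xi) (EFin \o phi) \o Z) w)%E; last first.
  by apply: eq_integral => w _; exact: FE.
rewrite -(@integral_distribution _ _ _ _ _ P Z); last 2 first.
- exact: measurable_int iF.
- move: iFZ; apply: eq_integrable => // w _ /=; exact/esym/FE.
rewrite integral12_prod_meas1 // (eq_measure_integral _ (fun A mA _ => joint_law mA)).
by rewrite integral_distribution.
Qed.

End Independence.

(** * Stochastic oracles *)

Section Oracle.
Variables (R : realType) (d n m : nat) (X : set 'rV[R]_d) (Y : set 'rV[R]_n).
Hypotheses (closedX : closed X) (closedY : closed Y).
Variables (dS : measure_display) (S : measurableType dS).
Variable G : 'rV[R]_d -> 'rV[R]_n -> S -> 'rV[R]_m.
Hypothesis mG : measurable_oracle X Y G.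

Lemma row_of_tuple_measurable p : vmeasurable (@row_of_tuple R p).
Proof.
move=> i; under eq_fun do rewrite mxE.
exact: measurable_tnth.
Qed.

(** The oracle is measurable on X x Y only. That domain is measurable because X and Y are closed,
    and the composite never leaves it. *)
Lemma vmeasurable_oracle (dU : measure_display) (U : measurableType dU)
    (a : U -> 'rV[R]_d) (b : U -> 'rV[R]_n) (s : U -> S) :
  vmeasurable a -> vmeasurable b -> measurable_fun setT s ->
  (forall z, X (a z)) -> (forall z, Y (b z)) ->
  vmeasurable (fun z => G (a z) (b z) (s z)).
Proof.
move=> ma mb ms Xa Yb i.
pose tup p (c : U -> 'rV[R]_p) z := [tuple c z 0 j | j < p].
have tupK p (c : U -> 'rV[R]_p) z : row_of_tuple (tup p c z) = c z.
  by apply/rowP => j; rewrite mxE tnth_mktuple.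
have mtup p (c : U -> 'rV[R]_p) : vmeasurable c -> measurable_fun setT (tup p c).
  move=> mc; apply/measurable_fun_tnthP => j.
  apply: (eq_measurable_fun (fun z => c z 0 j)); last exact: mc.
  by move=> z _ /=; rewrite tnth_mktuple.
pose D : set (d.-tuple R * n.-tuple R * S) :=
  [set z | X (row_of_tuple z.1.1) /\ Y (row_of_tuple z.1.2)].
have mD : measurable D.
  apply: measurableI.
    apply: (@vmeasurable_closed _ _ _ _ (fun z : d.-tuple R * n.-tuple R * S => row_of_tuple z.1.1)) => //.
    move=> j; apply: (measurableT_comp (row_of_tuple_measurable j)).
    by apply: measurableT_comp.
  apply: (@vmeasurable_closed _ _ _ _ (fun z : d.-tuple R * n.-tuple R * S => row_of_tuple z.1.2)) => //.
  move=> j; apply: (measurableT_comp (row_of_tuple_measurable j)).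
  by apply: measurableT_comp.
apply: (eq_measurable_fun ((fun z : d.-tuple R * n.-tuple R * S =>
   G (row_of_tuple z.1.1) (row_of_tuple z.1.2) z.2 0 i) \o
   (fun z => (tup d a z, tup n b z, s z)))).
  by move=> z _ /=; rewrite !tupK.
have sub : range (fun z => (tup d a z, tup n b z, s z)) `<=` D.
  by move=> _ [z _ <-] /=; rewrite /D /= !tupK.
have mp : measurable_fun setT (fun z => (tup d a z, tup n b z, s z)).
  by apply: measurable_fun_pair => //; apply: measurable_fun_pair; exact: mtup.
exact: (measurable_comp mD sub (mG i) mp).
Qed.

Variables (dO dT : measure_display) (Omega : measurableType dO) (T : measurableType dT).
Variables (P : probability Omega R) (Z : {RV P >-> T}) (xi : {RV P >-> S}).
Hypothesis indep : forall A B, measurable A -> measurable B ->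
  P (Z @^-1` A `&` xi @^-1` B) = (P (Z @^-1` A) * P (xi @^-1` B))%E.
Variable M : R.
Hypothesis G_le : forall x y, X x -> Y y ->
  ('E_P[fun w => (enorm (G x y (xi w)) ^+ 2)%R] <= (M ^+ 2)%:E)%E.
Variables (a : T -> 'rV[R]_d) (b : T -> 'rV[R]_n).
Hypotheses (ma : vmeasurable a) (mb : vmeasurable b).
Hypotheses (Xa : forall z, X (a z)) (Yb : forall z, Y (b z)).

Let g w := G (a (Z w)) (b (Z w)) (xi w).

Lemma oracle_section_sqintegrable x y : X x -> Y y ->
  sqintegrable P (fun w => G x y (xi w)).
Proof.
move=> Xx Yy; have mg : vmeasurable (fun w => G x y (xi w)).
  by apply: vmeasurable_oracle => //; exact: vmeasurable_cst.
have := G_le Xx Yy; rewrite unlock => le.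
have [] // := ge0_integral_bounded (measurable_sqr_enorm mg) _ le.
by move=> w; exact: sqr_ge0.
Qed.

Let prod_measurable :
  vmeasurable (fun z : T * S => G (a z.1) (b z.1) z.2).
Proof.
apply: vmeasurable_oracle => //.
- by move=> i; apply: (measurableT_comp (ma i)).
- by move=> i; apply: (measurableT_comp (mb i)).
Qed.

Lemma oracle_vmeasurable : vmeasurable g.
Proof.
apply: vmeasurable_oracle => //.
- by move=> i; apply: (measurableT_comp (ma i)).
- by move=> i; apply: (measurableT_comp (mb i)).
Qed.

Lemma oracle_second_moment : sqintegrable P g /\
  \int[P]_w enorm (g w) ^+ 2 <= M ^+ 2.
Proof.
have mE := measurable_sqr_enorm oracle_vmeasurable.
have le : (\int[P]_w (enorm (g w) ^+ 2)%:E <= (M ^+ 2)%:E)%E.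
  rewrite (ge0_integral_indep indep
    (phi := fun z => (enorm (G (a z.1) (b z.1) z.2) ^+ 2)%:E)) //=; last 2 first.
  - exact/measurable_EFinP/measurable_sqr_enorm.
  - by move=> z; rewrite lee_fin sqr_ge0.
  apply: (@le_trans _ _ (\int[P]_w (M ^+ 2)%:E)%E); last first.
    by rewrite integral_cst // [X in (_ * X)%E]probability_setT mule1.
  apply: ge0_le_integral => //.
  - by move=> w _; apply: integral_ge0 => w' _; rewrite lee_fin sqr_ge0.
  (* Measurability of the inner integral: it is [fubini_F] composed with [Z]. *)
  - apply: (eq_measurable_fun (fubini_F (distribution P xi)
      (fun z => (enorm (G (a z.1) (b z.1) z.2) ^+ 2)%:E) \o Z)).
      move=> w _ /=; rewrite /fubini_F ge0_integral_distribution //.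
        apply/measurable_EFinP/measurable_sqr_enorm.
        apply: (@vmeasurable_oracle _ S (fun=> a (Z w)) (fun=> b (Z w)) id) => //;
          exact: vmeasurable_cst.
      by move=> y; rewrite lee_fin sqr_ge0.
    apply: measurableT_comp => //; apply: measurable_fun_fubini_tonelli_F.
      exact/measurable_EFinP/measurable_sqr_enorm.
    by move=> z; rewrite lee_fin sqr_ge0.
  - by move=> w _; have := G_le (Xa (Z w)) (Yb (Z w)); rewrite unlock.
have [|ig le'] := ge0_integral_bounded mE _ le; first by move=> w; exact: sqr_ge0.
by split => //; split => //; exact: oracle_vmeasurable.
Qed.

(** Unbiasedness against directions determined by the past: with [Z] frozen, both the query point
    and the direction are constant, and the sample may be averaged alone. *)
Lemma oracle_dot_mean (h : T -> 'rV[R]_m) :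
  vmeasurable h -> sqintegrable P (h \o Z) ->
  let gbar w := mean_vector P (fun w' => G (a (Z w)) (b (Z w)) (xi w')) in
  P.-integrable setT (EFin \o (fun w => dot (gbar w) (h (Z w)))) /\
  \int[P]_w dot (g w) (h (Z w)) = \int[P]_w dot (gbar w) (h (Z w)).
Proof.
move=> mh sh gbar; have [sg _] := oracle_second_moment.
have sec w : \int[P]_w' dot (G (a (Z w)) (b (Z w)) (xi w')) (h (Z w)) =
    dot (gbar w) (h (Z w)).
  rewrite Rintegral_dot_cst //; exact: oracle_section_sqintegrable.
have [||w|] := @integral_indep _ _ _ _ _ _ _ P Z xi indep
   (fun z => dot (G (a z.1) (b z.1) z.2) (h z.1)).
- apply: measurable_dot => // i; exact: (measurableT_comp (mh i)).
- exact: integrable_dot.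
- apply: integrable_dot => /=; last exact: (sqintegrable_cst P (h (Z w))).
  exact: oracle_section_sqintegrable.
move=> /= i1 e1; split.
  by move: i1; apply: eq_integrable => // w _ /=; rewrite sec.
by rewrite /g e1; apply: eq_Rintegral => w _; exact: sec.
Qed.

End Oracle.

(** * The sigma-algebra of past oracle calls *)

Section Past.
Variables (R : realType) (dO dS : measure_display).
Variables (Omega : measurableType dO) (S : measurableType dS).
Variables (P : probability Omega R) (xi : nat -> nat -> {RV P >-> S}).
Implicit Types I J : set (nat * nat).

(** A copy of [Omega] carrying the sigma-algebra generated by the calls in [I]. Adaptedness becomes
    measurability on this type, and the identity into it is the variable [Z] of the independence
    lemmas. *)
Definition past I :=
  g_sigma_algebraType (\bigcup_(i in I) sigma_of (xi i.1 i.2 : Omega -> S)).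

Definition adapted I d (u : Omega -> 'rV[R]_d) :=
  vmeasurable (T := past I) (u : past I -> 'rV[R]_d).

Lemma past_sub I : (measurable : set (set (past I))) `<=` (measurable : set (set Omega)).
Proof.
apply: smallest_sub; first exact: sigma_algebra_measurable.
by move=> B [i _ [C mC <-]]; rewrite setTI; exact: measurable_funPTI.
Qed.

Lemma measurable_past_id I : measurable_fun setT (id : Omega -> past I).
Proof. by move=> _ B mB; rewrite setTI; exact: (@past_sub I). Qed.

Definition past_id I : {RV P >-> past I} := mfun_Sub (mem_set (@measurable_past_id I)).

Lemma adapted_vmeasurable I d (u : Omega -> 'rV[R]_d) : adapted I u -> vmeasurable u.
Proof. by move=> au i _ B mB; apply: (@past_sub I); exact: au. Qed.

Lemma adaptedS I J d (u : Omega -> 'rV[R]_d) : I `<=` J -> adapted I u -> adapted J u.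
Proof.
move=> IJ au i _ B mB; have := au i measurableT B mB.
by apply: sub_sigma_algebra2; exact: bigcup_subset.
Qed.

Lemma measurable_past I k t : I (k, t) ->
  measurable_fun setT (xi k t : past I -> S).
Proof.
move=> Ikt _ B mB; apply: sub_sigma_algebra; exists (k, t) => //.
by exists B.
Qed.

End Past.

Section Lincomb.
Variables (R : realType) (dT : measure_display) (T : measurableType dT).
Variable P : probability T R.

Fixpoint all_integrable (s : seq (R * (T -> R))) : Prop :=
  if s is p :: s' then P.-integrable setT (EFin \o p.2) /\ all_integrable s'
  else True.

(** Carries a pointwise linear inequality with several terms over to expectations in one go, once
    each term is known to be integrable. *)
Lemma Rintegral_lincomb_ge0 (s : seq (R * (T -> R))) : all_integrable s ->
  (forall w, 0 <= \sum_(p <- s) p.1 * p.2 w) ->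
  0 <= \sum_(p <- s) p.1 * \int[P]_w p.2 w.
Proof.
move=> is_ s0; have : 0 <= \int[P]_w (\sum_(p <- s) p.1 * p.2 w).
  exact: Rintegral_ge0.
suff [_ ->] : P.-integrable setT (EFin \o (fun w => \sum_(p <- s) p.1 * p.2 w)) /\
  \int[P]_w (\sum_(p <- s) p.1 * p.2 w) = \sum_(p <- s) p.1 * \int[P]_w p.2 w by [].
elim: s is_ {s0} => [_|[c f] s IH /= [fi /IH [si e]]].
  split; first by under eq_fun do rewrite big_nil; exact: integrable_const.
  by under eq_Rintegral do rewrite big_nil; rewrite big_nil Rintegral_cst // mul0r.
split.
  have := integrable_lin c 1 fi si; apply: eq_integrable => // w _ /=.
  by rewrite big_cons mul1r.
rewrite big_cons -e /= -[X in _ + X]mul1r -Rintegral_lin //.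
by apply: eq_Rintegral => w _; rewrite big_cons mul1r.
Qed.

End Lincomb.

(** * Measurability and second moments of proximal iterates *)

Section ProxIterate.
Variables (R : realType) (dO dS : measure_display).
Variables (Omega : measurableType dO) (S : measurableType dS).
Variables (P : probability Omega R) (xi : nat -> nat -> {RV P >-> S}).
Variables (d : nat) (X : set 'rV[R]_d) (convexX : convex_set X).

Lemma prox_iterate I (g p q z : Omega -> 'rV[R]_d) (eta beta : R) :
  0 < eta -> 0 <= beta -> (forall w, X (p w)) ->
  (forall w, is_argmin X (fun z => dot z (g w)
      + (2 * eta)^-1 * enorm (z - p w) ^+ 2
      + beta * enorm (z - q w) ^+ 2) (z w)) ->
  adapted xi I g -> adapted xi I p -> adapted xi I q ->
  sqintegrable P g -> sqintegrable P p -> sqintegrable P q ->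
  adapted xi I z /\ sqintegrable P z.
Proof.
move=> e0 b0 Xp zmin ag ap aq sg sp sq.
have a0 : 0 < (2 * eta)^-1 by rewrite invr_gt0 mulr_gt0.
have az : adapted xi I z.
  pose c := (2 * eta)^-1 + beta; have c0 : 0 < c by rewrite ltr_pwDl.
  (* Up to a constant, the objective is c |z|^2 - 2 <z, u>, so the minimizer depends on the data
     through [u] alone. *)
  pose u w := (- 2^-1) *: g w + ((2 * eta)^-1 *: p w + beta *: q w).
  apply: (@vmeasurable_dep _ _ (past xi I) _ _ u _ (c ^+ 2)^-1).
    by apply: vmeasurableD; [|apply: vmeasurableD]; exact: vmeasurableZ.
  move=> w w'; rewrite -(ler_pM2l (exprn_gt0 2 c0)) mulVKf ?gt_eqF ?exprn_gt0 //.
  have := argmin_prox_lip convexX a0 b0 (zmin w) (zmin w').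
  congr (_ <= enorm _ ^+ 2); rewrite /u; apply/rowP => i; rewrite !mxE; ring.
split => //.
have sD : sqintegrable P (fun w => z w - p w).
  apply: (sqintegrable_le (a := eta ^+ 2) (b := 2 * eta * beta) (c := 0) _ sg (sqintegrableB sp sq)).
    by apply: vmeasurableB; [exact: adapted_vmeasurable az|case: sp].
  by move=> w; rewrite addr0; apply: (prox_step_sqr convexX).
have := sqintegrableD sD sp; congr (sqintegrable P _).
by apply/funext => w; rewrite subrK.
Qed.

(** The Lipschitz bound relative to one fixed outcome [w0] dominates z - z w0 by the
    square-integrable u - u w0. *)
Lemma sqintegrable_lip d' (u : Omega -> 'rV[R]_d) (z : Omega -> 'rV[R]_d') (C : R) :
  0 <= C -> vmeasurable z -> sqintegrable P u ->
  (forall w w', enorm (z w - z w') ^+ 2 <= C * enorm (u w - u w') ^+ 2) ->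
  sqintegrable P z.
Proof.
move=> C0 mz su lip; pose w0 : Omega := point.
have sD : sqintegrable P (fun w => z w - z w0).
  have su' := sqintegrableB su (sqintegrable_cst P (u w0)).
  apply: (sqintegrable_le (a := C) (b := 0) (c := 0) _ su' su').
    by apply: vmeasurableB => //; exact: vmeasurable_cst.
  by move=> w; rewrite mul0r !addr0.
have := sqintegrableD sD (sqintegrable_cst P (z w0)); congr (sqintegrable P _).
by apply/funext => w; rewrite subrK.
Qed.

End ProxIterate.

(** Jensen's inequality, by summing |u_t|^2 >= 2 <u_t, c> - |c|^2 at the mean [c]. *)
Lemma sqr_enorm_mean (R : realType) d (u : nat -> 'rV[R]_d) (N : nat) : (0 < N)%N ->
  enorm (N%:R^-1 *: \sum_(t < N) u t) ^+ 2 <= N%:R^-1 * \sum_(t < N) enorm (u t) ^+ 2.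
Proof.
move=> N0; set c := _ *: _.
have Np : 0 < N%:R :> R by rewrite ltr0n.
rewrite -(ler_pM2l Np) mulVKf ?gt_eqF //.
have sumE : \sum_(t < N) dot (u t) c = N%:R * enorm c ^+ 2.
  rewrite sqr_enorm {2}/c dotZl mulVKf ?gt_eqF //.
  by elim/big_rec2 : _ => [|i y1 y2 _ ->]; rewrite ?dot0l // dotDl.
clearbody c; have : \sum_(t < N) (2 * dot (u t) c - enorm c ^+ 2) <= \sum_(t < N) enorm (u t) ^+ 2.
  apply: ler_sum => i _; have := dot_ge0 (u i - c).
  rewrite !sqr_enorm !dotE (dotC c); lra.
rewrite sumrB -mulr_sumr sumE sumr_const card_ord -mulr_natl; lra.
Qed.

(** * Recursions and the number of epochs *)

Lemma ceiln_itv (R : realType) (x : R) : 0 <= x -> x <= (ceiln x)%:R < x + 1.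
Proof.
move=> x0; have c0 : 0 <= Num.ceil x.
  by rewrite -(ler_int R) (le_trans x0) // ceil_ge.
rewrite /ceiln natr_absz ger0_norm // ceil_ge /=.
have /andP[+ _] := ceil_itv x; rewrite intrB; lra.
Qed.

Lemma nb_steps_itv (R : realType) k :
  106 * k.+1%:R / 3 <= ((nb_steps R k)%:R : R) < 106 * k.+1%:R / 3 + 1.
Proof. by apply: ceiln_itv; rewrite divr_ge0 // mulr_ge0. Qed.

Lemma nb_steps_gt0 (R : realType) k : (0 < nb_steps R k)%N.
Proof.
have /andP[h _] := nb_steps_itv R k; rewrite -(ltr0n R).
by apply: lt_le_trans h; rewrite divr_gt0 // mulr_gt0.
Qed.

Section Recursions.
Variable R : realType.

(** A step controls [u] at t + 1, while the averages run over t < T; this shift is what adds [rho]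
    to the weight of the initial distance. *)
Lemma telescope_steps (T : nat) (rho lam ax ay N : R) (u v w : nat -> R) :
  0 <= rho -> 0 <= ax -> 0 <= ay -> w 0%N = 0 ->
  (forall t, 0 <= u t) -> (forall t, 0 <= v t) -> (forall t, 0 <= w t) ->
  (forall t, (t < T)%N -> lam * v t + rho * u t.+1 <=
    rho * (w t - w t.+1) + ax * (u t - u t.+1) + ay * (v t - v t.+1) + N) ->
  rho * (\sum_(t < T) u t) + lam * (\sum_(t < T) v t) <=
    (ax + rho) * u 0%N + ay * v 0%N + T%:R * N.
Proof.
move=> r0 ax0 ay0 w0 u_ge0 v_ge0 w_ge0 step.
suff : rho * (\sum_(t < T) u t) + lam * (\sum_(t < T) v t) <=
    ax * (u 0%N - u T) + rho * (u 0%N - u T) - rho * w T + ay * (v 0%N - v T) + T%:R * N.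
  have := mulr_ge0 ax0 (u_ge0 T); have := mulr_ge0 r0 (u_ge0 T).
  have := mulr_ge0 r0 (w_ge0 T); have := mulr_ge0 ay0 (v_ge0 T); lra.
elim: T step => [|T IH] step.
  by rewrite !big_ord0 w0 !subrr; lra.
have := IH (fun t tT => step t (ltnW tT)); have := step T (ltnSn T).
rewrite !big_ord_recr /= -natr1; lra.
Qed.

Lemma epoch_contraction (k T : nat) (rho lam u0 v0 su sv sigma : R) :
  (0 < k)%N -> 0 <= rho -> 0 <= lam -> 0 <= u0 -> 0 <= v0 ->
  106 * k.+1%:R / 3 <= (T%:R : R) ->
  rho * su + lam * sv <= (rho * k.+1%:R / 8 + rho) * u0
    + (lam * k.+1%:R / 4) * v0 + T%:R * (sigma / k.+1%:R) ->
  rho * (T%:R^-1 * su) + lam * (T%:R^-1 * sv) <=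
    rho * u0 / 50 + lam * v0 / 100 + sigma / k.+1%:R.
Proof.
move=> k0 r0 l0 u0_ge0 v0_ge0 hT h.
have k2 : 2 <= k.+1%:R :> R by rewrite (ler_nat _ 2).
have T0 : 0 < T%:R :> R by apply: lt_le_trans hT; lra.
rewrite -(ler_pM2l T0) mulrDr !mulrDr ![T%:R * (_ * (T%:R^-1 * _))]mulrCA.
rewrite ![T%:R * (T%:R^-1 * _)]mulVKf ?gt_eqF //.
apply: le_trans h _; set s := T%:R * (sigma / _).
have ru := mulr_ge0 r0 u0_ge0; have lv := mulr_ge0 l0 v0_ge0.
(* As k + 1 >= 2, the left factor is at most 5/8 (k + 1), while T / 50 is at least 106/150 (k + 1).
   For [h2], compare 1/4 with 106/300. *)
have h1 : (k.+1%:R / 8 + 1) * (rho * u0) <= T%:R / 50 * (rho * u0).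
  by apply: ler_wpM2r => //; lra.
have h2 : k.+1%:R / 4 * (lam * v0) <= T%:R / 100 * (lam * v0).
  by apply: ler_wpM2r => //; lra.
lra.
Qed.

(** Writing S for sums over the epochs, eliminating SB leaves 96 Sa + 98 Sb <= 6 SA + 2 e + 100
    sigma Sh. With SA <= e + Sa this becomes 90 SA <= 98 e + 100 sigma Sh. *)
Lemma sum_recursion (K : nat) (A B a b h : nat -> R) (e sigma : R) : (0 < K)%N ->
  (forall k, 0 <= A k) -> (forall k, 0 <= B k) ->
  (forall k, 0 <= a k) -> (forall k, 0 <= b k) -> 0 <= e ->
  0 <= sigma -> (forall k, 0 <= h k) ->
  \sum_(k < K) (A k - a k) <= e -> B 0%N <= 2 * e ->
  (forall k, (k.+1 < K)%N -> B k.+1 <= 2 * b k + 4 * A k + 4 * a k) ->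
  (forall k, (k < K)%N -> a k + b k <= A k / 50 + B k / 100 + sigma * h k) ->
  \sum_(k < K) A k <= 2 * e + 2 * sigma * \sum_(k < K) h k.
Proof.
move=> K0 A0 B0 a0 b0 e0 s0 h0; rewrite sumrB => hA hB hBS hab.
have hB' : \sum_(k < K) B k <=
    2 * e + \sum_(k < K) (2 * b k + 4 * A k + 4 * a k).
  case: K K0 hBS {hA hab} => // K _ hBS.
  rewrite big_ord_recl [in leRHS]big_ord_recr /=.
  have H : \sum_(i < K) B (bump 0 i) <= \sum_(i < K) (2 * b i + 4 * A i + 4 * a i).
    by apply: ler_sum => i _; apply: hBS; rewrite ltnS.
  apply: le_trans (lerD hB H) _; rewrite lerD2l lerDl.
  by rewrite !addr_ge0 ?mulr_ge0.
have hab' : \sum_(k < K) (a k + b k) <=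
    \sum_(k < K) (A k / 50 + B k / 100 + sigma * h k).
  by apply: ler_sum => i _; exact: hab.
move: hab' hB'; rewrite !big_split /= -!mulr_suml -!mulr_sumr.
have SA : 0 <= \sum_(k < K) A k by apply: sumr_ge0.
have Sb : 0 <= \sum_(k < K) b k by apply: sumr_ge0.
have Sa : 0 <= \sum_(k < K) a k by apply: sumr_ge0.
have SH : 0 <= sigma * \sum_(k < K) h k by rewrite mulr_ge0 //; apply: sumr_ge0.
lra.
Qed.

Lemma harmonic_le (K : nat) : \sum_(k < K) (k.+2%:R^-1 : R) <= ln (K.+1%:R).
Proof.
elim: K => [|K IH]; first by rewrite big_ord0 ln1.
rewrite big_ord_recr /=.
rewrite -lerBrDr; apply: le_trans IH _.
rewrite lerBrDr -lerBrDl -lerN2 opprB.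
rewrite -ln_div ?posrE ?ltr0n //.
have K2 : 0 < K.+2%:R :> R by rewrite ltr0n.
have -> : K.+1%:R / K.+2%:R = 1 + - K.+2%:R^-1 :> R.
  apply: (mulIf (lt0r_neq0 K2)).
  by rewrite divfK ?gt_eqF // mulrDl mulNr mulVf ?gt_eqF // mul1r -[K.+2%:R]natr1 addrK.
have K3 : K.+2%:R^-1 < 1 :> R by rewrite invf_lt1 // ltr1n.
by apply: le_ln1Dx; rewrite ltrN2.
Qed.

(** Solves the implicit condition that K dominate D ln K: split ln (K + 1) = ln D + ln ((K + 1) / D)
    and bound the last logarithm by its argument, so that D ln (K + 1) <= D ln D + K + 1 <= 3 K. For
    D <= 1 each summand is at most 1. *)
Lemma harmonic_epochs (K : nat) (D : R) : (0 < K)%N -> 0 <= D ->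
  D * ln D <= K%:R -> D * \sum_(k < K) k.+2%:R^-1 <= 3 * K%:R.
Proof.
move=> K0 D0 hK; have K1 : 1 <= K%:R :> R by rewrite ler1n.
have [D1|D1] := leP D 1.
  have H0 : 0 <= \sum_(k < K) (k.+2%:R^-1 : R) by apply: sumr_ge0.
  have HK : \sum_(k < K) (k.+2%:R^-1 : R) <= K%:R.
    rewrite -[leRHS](_ : \sum_(k < K) 1 = _); last by rewrite sumr_const card_ord.
    by apply: ler_sum => i _; rewrite invf_le1 // ler1n.
  have : D * \sum_(k < K) (k.+2%:R^-1 : R) <= 1 * \sum_(k < K) (k.+2%:R^-1 : R).
    exact: ler_wpM2r.
  lra.
have Dp : 0 < D by lra.
have lnK : ln (K.+1%:R) <= ln D + K.+1%:R / D.
  have -> : K.+1%:R = D * (K.+1%:R / D) :> R by rewrite mulrC divfK ?gt_eqF.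
  rewrite lnM ?posrE ?divr_gt0 // lerD2l [X in _ <= X]mulrC mulrA mulVf ?gt_eqF // mul1r.
  by rewrite ltW // ln_sublinear // divr_gt0.
have := le_trans (harmonic_le K) lnK.
rewrite -(ler_pM2l Dp) mulrDr [D * (_ / D)]mulrC divfK ?gt_eqF // -natr1; lra.
Qed.

End Recursions.

(** * The total number of iterations *)

Section TotalSteps.
Variables (R : realType) (rho lam gamma M1 M2 eps0 : R).
Hypotheses (rho_gt0 : 0 < rho) (lam_gt0 : 0 < lam) (gamma_gt0 : 0 < gamma).
Hypothesis eps0_gt0 : 0 < eps0.

Let n1696 : 0 <= 1696 :> R. Proof. by rewrite ler0n. Qed.
Let n1376 : 0 < 1376 :> R. Proof. by rewrite ltr0n. Qed.
Let n5 : 0 < 5 :> R. Proof. by rewrite ltr0n. Qed.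

Lemma noise_level_ge0 : 0 <= 2 * M1 ^+ 2 / rho + M2 ^+ 2 / lam.
Proof.
apply: addr_ge0; apply: divr_ge0; rewrite ?sqr_ge0 ?(ltW rho_gt0) ?(ltW lam_gt0) //.
by rewrite mulr_ge0 ?sqr_ge0.
Qed.

Let c_ge0 : 0 <= 1696 * gamma * (2 * M1 ^+ 2 / rho + M2 ^+ 2 / lam).
Proof. exact: mulr_ge0 (mulr_ge0 n1696 (ltW gamma_gt0)) noise_level_ge0. Qed.

Let e_gt0 : 0 < 1376 * gamma * eps0.
Proof. exact: mulr_gt0 (mulr_gt0 n1376 gamma_gt0) eps0_gt0. Qed.

Lemma nb_epochs_itv (eps : R) : 0 < eps ->
  let D := 1696 * gamma * (2 * M1 ^+ 2 / rho + M2 ^+ 2 / lam) / eps ^+ 2 in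
  let E := 1376 * gamma * eps0 / (5 * eps ^+ 2) in
  [/\ 0 <= D, 0 < E & Num.max (D * ln D) E <=
    (nb_epochs rho lam gamma M1 M2 eps0 eps)%:R < Num.max (D * ln D) E + 1].
Proof.
move=> e0 D E.
have E0 : 0 < E := divr_gt0 e_gt0 (mulr_gt0 n5 (exprn_gt0 2 e0)).
have D0 : 0 <= D := divr_ge0 c_ge0 (exprn_ge0 2 (ltW e0)).
split; [exact: D0|exact: E0|].
by apply: ceiln_itv; rewrite le_max (ltW E0) orbT.
Qed.

Lemma nb_epochs_gt0 (eps : R) : 0 < eps ->
  (0 < nb_epochs rho lam gamma M1 M2 eps0 eps)%N.
Proof.
move=> e0; have [_ E0 /andP[h _]] := nb_epochs_itv e0.
rewrite -(ltr0n R); apply: lt_le_trans h; by rewrite lt_max E0 orbT.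
Qed.

Lemma total_steps_le (eps : R) : 0 < eps ->
  (total_steps rho lam gamma M1 M2 eps0 eps)%:R <=
  72 * (nb_epochs rho lam gamma M1 M2 eps0 eps)%:R ^+ 2 :> R.
Proof.
move=> e0; have K1 : 1 <= (nb_epochs rho lam gamma M1 M2 eps0 eps)%:R :> R.
  by rewrite ler1n nb_epochs_gt0.
rewrite /total_steps; move: K1; set K := nb_epochs _ _ _ _ _ _ _ => K1.
rewrite natr_sum.
(* For k <= K and K >= 1, 106 (k + 1) / 3 + 1 <= 212 K / 3 + K, which is below 72 K. *)
apply: (@le_trans _ _ (\sum_(1 <= k < K.+1) (72 * K%:R : R))).
  rewrite big_nat [leRHS]big_nat; apply: ler_sum => k /andP[_ kK].
  have /andP[_ h] := nb_steps_itv R k; apply: (le_trans (ltW h)).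
  have : k.+1%:R <= K%:R + 1 :> R by rewrite natr1 ler_nat.
  lra.
rewrite big_const_nat subSS subn0 iter_addr_0 -mulr_natr expr2; lra.
Qed.

Lemma total_steps_soft_O :
  soft_O (fun eps => (total_steps rho lam gamma M1 M2 eps0 eps)%:R)
         (fun eps => (eps ^+ 4)^-1).
Proof.
(* The number of epochs is of order ln (1/e) / e^2, and the number of steps of the order of its
   square. *)
exists 2%N.
pose c := 1696 * gamma * (2 * M1 ^+ 2 / rho + M2 ^+ 2 / lam).
pose E0 := 1376 * gamma * eps0 / 5.
(* One summand for each term of the maximum and one for rounding up; ln (c / e^2) = ln c + 2 L is at
   most (|ln c| + 2) L once L = ln (1/e) >= 1. *)
pose C1 := c * (`|ln c| + 2) + E0 + 1.
have c0 : 0 <= c := c_ge0.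
have E00 : 0 <= E0 := divr_ge0 (ltW e_gt0) (ltW n5).
have cE : 1696 * gamma * (2 * M1 ^+ 2 / rho + M2 ^+ 2 / lam) = c by [].
have EE : 1376 * gamma * eps0 / 5 = E0 by [].
clearbody c E0.
have C10 : 0 <= C1 by rewrite !addr_ge0 // mulr_ge0 // addr_ge0.
apply/eqOP; near=> k => /=.
have hk : 72 * C1 ^+ 2 <= k by near: k; apply: nbhs_pinfty_ge; exact: num_real.
near=> e.
have e0 : 0 < e by near: e; exact: nbhs_right_gt.
have e1 : e < expR (-1) by near: e; apply: nbhs_right_lt; exact: expR_gt0.
have L1 : 1 <= ln (e^-1).
  rewrite lnV ?posrE // lerNr -[leRHS]expRK ler_ln ?posrE ?expR_gt0 //; exact: ltW.
set L := ln (e^-1) in L1 *.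
have e2 : e <= 1.
  by rewrite (le_trans (ltW e1)) // -expR0 ler_expR; lra.
have ei0 : 0 < e^-1 by rewrite invr_gt0.
have ei : 1 <= e^-1 by rewrite invf_ge1.
set i2 := (e^-1) ^+ 2.
have i21 : 1 <= i2 by rewrite /i2 expr_ge1 // ltW.
have Ki : (nb_epochs rho lam gamma M1 M2 eps0 e)%:R <= C1 * (L * i2).
  have [_ _ /andP[_]] := nb_epochs_itv e0; rewrite cE => h; apply: (le_trans (ltW h)).
  have Li : 1 <= L * i2 by nra.
  have h1 : c / e ^+ 2 * ln (c / e ^+ 2) <= c * (`|ln c| + 2) * (L * i2).
    have [->|cn0] := eqVneq c 0; first by rewrite !mul0r.
    have cp : 0 < c by rewrite lt_def cn0.
    rewrite ln_div ?posrE ?exprn_gt0 // lnXn // -exprVn -/i2.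
    have -> : ln c - ln e *+ 2 = ln c + 2 * L.
      by rewrite /L lnV ?posrE // mulrN mulr_natl.
    have h3 : ln c + 2 * L <= (`|ln c| + 2) * L.
      have := ler_norm (ln c); have := normr_ge0 (ln c); nra.
    have ci : 0 <= c * i2 by rewrite mulr_ge0 // (le_trans _ i21).
    have := ler_wpM2l ci h3; lra.
  have h2 : 1376 * gamma * eps0 / (5 * e ^+ 2) <= E0 * (L * i2).
    rewrite (_ : _ / _ = E0 * i2); last by rewrite -EE invfM /i2 exprVn mulrA.
    have := ler_wpM2l E00 (_ : i2 <= L * i2); apply.
    by rewrite ler_peMl // (le_trans _ i21).
  have Li0 : 0 <= L * i2 := le_trans ler01 Li.
  have q : 0 <= c * (`|ln c| + 2) * (L * i2).
    exact: mulr_ge0 (mulr_ge0 c0 (addr_ge0 (normr_ge0 _) (ler0n _ 2))) Li0.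
  have q2 : 0 <= E0 * (L * i2) by exact: mulr_ge0 E00 Li0.
  rewrite /C1; have : Num.max (c / e ^+ 2 * ln (c / e ^+ 2))
     (1376 * gamma * eps0 / (5 * e ^+ 2)) <= c * (`|ln c| + 2) * (L * i2) + E0 * (L * i2).
    by rewrite ge_max; apply/andP; split; lra.
  lra.
rewrite ger0_norm // ger0_norm; last first.
  by rewrite mulr_ge0 ?invr_ge0 ?exprn_ge0 // ltW // (lt_le_trans _ L1).
apply: (le_trans (total_steps_le e0)).
have -> : (e ^+ 4)^-1 * L ^+ 2 = (L * i2) ^+ 2.
  by rewrite exprMn /i2 -exprM -exprVn mulrC.
apply: (@le_trans _ _ (72 * (C1 * (L * i2)) ^+ 2)).
  rewrite ler_pM2l // ler_sqr ?nnegrE //.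
  by rewrite (le_trans _ Ki).
by rewrite exprMn mulrA ler_wpM2r ?sqr_ge0.
Unshelve. all: by end_near. Qed.

End TotalSteps.

(** * A run of the algorithm *)

Section Run.
Variables (R : realType) (d n : nat) (X : set 'rV[R]_d) (Y : set 'rV[R]_n).
Variables (f : 'rV[R]_d -> 'rV[R]_n -> R) (rho lam M1 M2 eps0 : R).
Variables (x0 : 'rV[R]_d) (y0 : 'rV[R]_n) (K : nat).
Hypotheses (closedX : closed X) (convexX : convex_set X).
Hypotheses (closedY : closed Y) (convexY : convex_set Y).
Hypotheses (rho_gt0 : 0 < rho) (lam_gt0 : 0 < lam).
Hypothesis f_wcvx : forall y, Y y -> weakly_convex rho X (fun x => f x y).
Hypothesis f_sccv : forall x, X x -> strongly_concave lam Y (fun y => f x y).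
Hypotheses (Xx0 : X x0) (Yy0 : Y y0).
Hypothesis gap0 : (gap X Y f x0 y0 <= eps0%:E)%E.
Variables (dO dS : measure_display).
Variables (Omega : measurableType dO) (S : measurableType dS).
Variables (P : probability Omega R) (xi : nat -> nat -> {RV P >-> S}).
Variable Gx : 'rV[R]_d -> 'rV[R]_n -> S -> 'rV[R]_d.
Variable Gy : 'rV[R]_d -> 'rV[R]_n -> S -> 'rV[R]_n.
Variables (x : nat -> nat -> Omega -> 'rV[R]_d) (y : nat -> nat -> Omega -> 'rV[R]_n).
Variables (xhat : nat -> Omega -> 'rV[R]_d) (yhat : nat -> Omega -> 'rV[R]_n).
Hypotheses (mGx : measurable_oracle X Y Gx) (mGy : measurable_oracle X Y Gy).
Hypothesis bounds : forall k t, calls R K (k, t) ->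
  oracle_bounds X Y f M1 M2 P Gx Gy (xi k t).
Hypothesis fresh : fresh_samples P K (fun k t => xi k t : Omega -> S).
Hypothesis run : forall w, epoch_GDA X Y rho lam (2 * rho) K x0 y0 Gx Gy
  (fun k t => xi k t w) (fun k t => x k t w) (fun k t => y k t w).
Hypothesis saddle : forall k w, (1 <= k <= K)%N ->
  prox_saddle X Y f rho (x k 0%N w) (xhat k w) (yhat k w).

Local Notation T := (nb_steps R).
Local Notation before := (calls_before R K).

Lemma calls_before_step k t : before k t `<=` before k t.+1.
Proof.
move=> i [ci [ik|[ik it]]]; split => //; first by left.
by right; split => //; exact: ltn_trans it _.
Qed.

Lemma calls_before0 k t : before k 0 `<=` before k t.
Proof.
by move=> i [ci [ik|[_]]] //; split => //; left.
Qed.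

Lemma calls_before_epoch k t : before k t `<=` before k.+1 0.
Proof.
move=> i [ci [ik|[ik it]]]; split => //; left; last by rewrite ik.
exact: ltn_trans ik _.
Qed.

Lemma past_indep k t : calls R K (k, t) -> forall A B,
  (measurable : set (set (past xi (before k t)))) A ->
  (measurable : set (set S)) B ->
  P (past_id xi (before k t) @^-1` A `&` xi k t @^-1` B) =
  (P (past_id xi (before k t) @^-1` A) * P (xi k t @^-1` B))%E.
Proof.
move=> c A B mA mB; rewrite setIC muleC; apply: (fresh c) => //.
by exists B => //; rewrite setTI.
Qed.

(** The invariant of the run: the iterate at step t of epoch k is feasible, has finite second
    moment, and is determined by the calls strictly before (k, t). *)
Definition regular_iterate k t :=
  [/\ forall w, X (x k t w), forall w, Y (y k t w),
      adapted xi (before k t) (x k t), adapted xi (before k t) (y k t) &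
      sqintegrable P (x k t) /\ sqintegrable P (y k t)].

Let half2 : 2 * rho / 2 = rho.
Proof. by rewrite mulrAC divff // mul1r. Qed.

Lemma x_step k t w : calls R K (k, t) ->
  is_argmin X (fun z => dot z (Gx (x k t w) (y k t w) (xi k t w))
     + (2 * (4 / (rho * k.+1%:R)))^-1 * enorm (z - x k t w) ^+ 2
     + rho * enorm (z - x k 0%N w) ^+ 2) (x k t.+1 w).
Proof. by move=> c; have [_ /(_ k t c) + _ _] := run w; rewrite /= half2. Qed.

(** The ascent step is put in the form of a descent step along -Gy with prox weight 0, so that the
    same lemmas serve both variables. *)
Lemma y_step k t w : calls R K (k, t) ->
  is_argmin Y (fun z => dot z (- Gy (x k t w) (y k t w) (xi k t w))
     + (2 * (2 / (lam * k.+1%:R)))^-1 * enorm (z - y k t w) ^+ 2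
     + 0 * enorm (z - y k 0%N w) ^+ 2) (y k t.+1 w).
Proof.
move=> c; have [_ _ /(_ k t c) + _] := run w; rewrite /=.
by congr (is_argmin Y _ _); apply/funext => z; rewrite mul0r addr0 dotNr.
Qed.

Let eta_x_gt0 k : 0 < 4 / (rho * k.+1%:R).
Proof. by rewrite divr_gt0 // mulr_gt0. Qed.

Let eta_y_gt0 k : 0 < 2 / (lam * k.+1%:R).
Proof. by rewrite divr_gt0 // mulr_gt0. Qed.

Section Oracles.
Variables (k t : nat).
Hypotheses (c : calls R K (k, t)) (g : regular_iterate k t).

Let gx w := Gx (x k t w) (y k t w) (xi k t w).
Let gy w := Gy (x k t w) (y k t w) (xi k t w).

Lemma gx_adapted : adapted xi (before k t.+1) gx.
Proof.
have [Xx Yy ax ay _] := g.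
apply: (vmeasurable_oracle closedX closedY mGx (U := past xi (before k t.+1))) => //.
- exact: adaptedS (@calls_before_step k t) ax.
- exact: adaptedS (@calls_before_step k t) ay.
- by apply: measurable_past; split => //; right.
Qed.

Lemma gy_adapted : adapted xi (before k t.+1) gy.
Proof.
have [Xx Yy ax ay _] := g.
apply: (vmeasurable_oracle closedX closedY mGy (U := past xi (before k t.+1))) => //.
- exact: adaptedS (@calls_before_step k t) ax.
- exact: adaptedS (@calls_before_step k t) ay.
- by apply: measurable_past; split => //; right.
Qed.

Lemma gx_second_moment :
  sqintegrable P gx /\ \int[P]_w enorm (gx w) ^+ 2 <= M1 ^+ 2.
Proof.
have [Xx Yy ax ay _] := g.
apply: (oracle_second_moment closedX closedY mGx (past_indep c) _ ax ay) => //.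
by move=> x1 y1 Xx1 Yy1; have [] := bounds c Xx1 Yy1.
Qed.

Lemma gy_second_moment :
  sqintegrable P gy /\ \int[P]_w enorm (gy w) ^+ 2 <= M2 ^+ 2.
Proof.
have [Xx Yy ax ay _] := g.
apply: (oracle_second_moment closedX closedY mGy (past_indep c) _ ax ay) => //.
by move=> x1 y1 Xx1 Yy1; have [] := bounds c Xx1 Yy1.
Qed.

Lemma gx_mean (h : Omega -> 'rV[R]_d) : adapted xi (before k t) h ->
  sqintegrable P h ->
  let gbar w := mean_vector P (fun w' => Gx (x k t w) (y k t w) (xi k t w')) in
  P.-integrable setT (EFin \o (fun w => dot (gbar w) (h w))) /\
  \int[P]_w dot (gx w) (h w) = \int[P]_w dot (gbar w) (h w).
Proof.
move=> ah sh; have [Xx Yy ax ay _] := g.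
apply: (oracle_dot_mean closedX closedY mGx (past_indep c) (M := M1) _ ax ay _ _ ah) => //.
by move=> x1 y1 Xx1 Yy1; have [] := bounds c Xx1 Yy1.
Qed.

Lemma gy_mean (h : Omega -> 'rV[R]_n) : adapted xi (before k t) h ->
  sqintegrable P h ->
  let gbar w := mean_vector P (fun w' => Gy (x k t w) (y k t w) (xi k t w')) in
  P.-integrable setT (EFin \o (fun w => dot (gbar w) (h w))) /\
  \int[P]_w dot (gy w) (h w) = \int[P]_w dot (gbar w) (h w).
Proof.
move=> ah sh; have [Xx Yy ax ay _] := g.
apply: (oracle_dot_mean closedX closedY mGy (past_indep c) (M := M2) _ ax ay _ _ ah) => //.
by move=> x1 y1 Xx1 Yy1; have [] := bounds c Xx1 Yy1.
Qed.

Lemma regular_step : regular_iterate k 0 -> regular_iterate k t.+1.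
Proof.
move=> [_ _ ax0 ay0 [sx0 sy0]]; have [Xx Yy ax ay [sx sy]] := g.
have [az sz] := prox_iterate convexX (eta_x_gt0 k) (ltW rho_gt0) Xx
  (fun w => x_step w c) gx_adapted (adaptedS (@calls_before_step k t) ax)
  (adaptedS (@calls_before0 k t.+1) ax0) gx_second_moment.1 sx sx0.
have agy : adapted xi (before k t.+1) (fun w => - gy w).
  under eq_fun do rewrite -scaleN1r.
  by apply: (vmeasurableZ (T := past xi _)); exact: gy_adapted.
have sgy : sqintegrable P (fun w => - gy w).
  under eq_fun do rewrite -scaleN1r.
  by apply: sqintegrableZ; exact: gy_second_moment.1.
have [az' sz'] := prox_iterate convexY (eta_y_gt0 k) (lexx 0) Yy
  (fun w => y_step w c) agy (adaptedS (@calls_before_step k t) ay)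
  (adaptedS (@calls_before0 k t.+1) ay0) sgy sy sy0.
split => // w; first by case: (x_step w c).
by case: (y_step w c).
Qed.

End Oracles.

Lemma regular_epoch k t : (1 <= k <= K)%N -> regular_iterate k 0 -> (t <= T k)%N -> regular_iterate k t.
Proof.
move=> kK g0; elim: t => // t IH tT; have c : calls R K (k, t) by exact/andP.
exact: regular_step c (IH (ltnW tT)) g0.
Qed.

Lemma regular_next k : (1 <= k <= K)%N -> regular_iterate k 0 -> regular_iterate k.+1 0.
Proof.
move=> kK g0; have gt t (tT : (t < T k)%N) := regular_epoch kK g0 (ltnW tT).
have xE : x k.+1 0%N = fun w => (T k)%:R^-1 *: \sum_(t < T k) x k t w.
  by apply/funext => w; have [_ _ _ /(_ k kK) [-> _]] := run w.
have yE : y k.+1 0%N = fun w => (T k)%:R^-1 *: \sum_(t < T k) y k t w.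
  by apply/funext => w; have [_ _ _ /(_ k kK) [_ ->]] := run w.
rewrite /regular_iterate xE yE; split.
- move=> w; apply: (convex_set_mean convexX (u := fun t => x k t w)) => [|t tT].
    exact: nb_steps_gt0.
  by have [] := gt t tT.
- move=> w; apply: (convex_set_mean convexY (u := fun t => y k t w)) => [|t tT].
    exact: nb_steps_gt0.
  by have [] := gt t tT.
- apply: vmeasurableZ; apply: vmeasurable_sum => t tT.
  by have [_ _ h _ _] := gt t tT; exact: adaptedS (@calls_before_epoch k t) h.
- apply: vmeasurableZ; apply: vmeasurable_sum => t tT.
  by have [_ _ _ h _] := gt t tT; exact: adaptedS (@calls_before_epoch k t) h.
- split; apply: sqintegrableZ; apply: sqintegrable_sum => t tT.
    by have [_ _ _ _ []] := gt t tT.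
  by have [_ _ _ _ []] := gt t tT.
Qed.

Lemma regular_start k : (1 <= k <= K.+1)%N -> regular_iterate k 0.
Proof.
elim: k => // -[_ _|k IH kK]; last by apply: regular_next; [|apply: IH]; rewrite ?(ltnW kK).
have xE : x 1%N 0%N = fun=> x0.
  by apply/funext => w; have [[-> _] _ _ _] := run w.
have yE : y 1%N 0%N = fun=> y0.
  by apply/funext => w; have [[_ ->] _ _ _] := run w.
rewrite /regular_iterate xE yE; split => //; try exact: vmeasurable_cst.
by split; exact: sqintegrable_cst.
Qed.

Section Saddles.
Variable k : nat.
Hypothesis kK : (1 <= k <= K)%N.

Let g0 : regular_iterate k 0.
Proof. by apply: regular_start; case/andP: kK => -> /leqW. Qed.

Let lip_x w w' : enorm (xhat k w - xhat k w') ^+ 2 <= 4 * enorm (x k 0%N w - x k 0%N w') ^+ 2.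
Proof.
exact: prox_saddle_lip_x rho_gt0 lam_gt0 f_wcvx f_sccv _ _ _ _ _ _
  (saddle w kK) (saddle w' kK).
Qed.

Let lip_y w w' : enorm (yhat k w - yhat k w') ^+ 2 <= (rho / lam) * enorm (x k 0%N w - x k 0%N w') ^+ 2.
Proof.
have := prox_saddle_lip_y rho_gt0 f_wcvx f_sccv (saddle w kK) (saddle w' kK).
by rewrite -ler_pdivlMl // mulrA [lam^-1 * rho]mulrC.
Qed.

(** Lipschitz dependence on the centre replaces a measurable selection, and shows that the
    comparator is already known when the epoch starts. *)
Lemma xhat_adapted : adapted xi (before k 0) (xhat k).
Proof. by have [_ _ ax _ _] := g0; exact: vmeasurable_dep ax lip_x. Qed.

Lemma yhat_adapted : adapted xi (before k 0) (yhat k).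
Proof. by have [_ _ ax _ _] := g0; exact: vmeasurable_dep ax lip_y. Qed.

Lemma xhat_sqintegrable : sqintegrable P (xhat k).
Proof.
have [_ _ _ _ [sx _]] := g0.
by apply: sqintegrable_lip sx lip_x => //; exact: adapted_vmeasurable xhat_adapted.
Qed.

Lemma yhat_sqintegrable : sqintegrable P (yhat k).
Proof.
have [_ _ _ _ [sx _]] := g0.
apply: sqintegrable_lip sx lip_y; last exact: adapted_vmeasurable yhat_adapted.
by rewrite divr_ge0 // ltW.
Qed.

End Saddles.

Local Notation sigma := (2 * M1 ^+ 2 / rho + M2 ^+ 2 / lam).

(** * One epoch in expectation *)

Section Epoch.
Variable k : nat.
Hypothesis kK : (1 <= k <= K)%N.

Let u t := \int[P]_w enorm (xhat k w - x k t w) ^+ 2.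
Let v t := \int[P]_w enorm (yhat k w - y k t w) ^+ 2.
Let q t := \int[P]_w enorm (x k t w - x k 0%N w) ^+ 2.

Let g0 : regular_iterate k 0.
Proof. by apply: regular_start; case/andP: kK => -> /leqW. Qed.

(** Add the expectations of the saddle inequality ([I1]) and of the two proximal steps ([I2], [I3]).
    The inner products cancel because the comparator is determined by the past, so [ex] and [ey] let
    the stochastic gradients be replaced by their means. *)
Lemma expected_step t : (t < T k)%N ->
  lam * v t + rho * u t.+1 <=
  rho * (q t - q t.+1) + (rho * k.+1%:R / 8) * (u t - u t.+1)
  + (lam * k.+1%:R / 4) * (v t - v t.+1) + sigma / k.+1%:R.
Proof.
move=> tT; have c : calls R K (k, t) by exact/andP.
have gt := regular_epoch kK g0 (ltnW tT); have gt1 := regular_epoch kK g0 tT.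
have [Xx Yy ax ay [sx sy]] := gt; have [_ _ _ _ [sx1 sy1]] := gt1.
have [_ _ _ _ [sx0 sy0]] := g0.
have [sxh syh] := (xhat_sqintegrable kK, yhat_sqintegrable kK).
have axh := adaptedS (@calls_before0 k t) (xhat_adapted kK).
have ayh := adaptedS (@calls_before0 k t) (yhat_adapted kK).
have [sgx gx2] := gx_second_moment c gt; have [sgy gy2] := gy_second_moment c gt.
have sh := sqintegrableB sx sxh; have sh' := sqintegrableB syh sy.
have [ibx ex] := gx_mean c gt (vmeasurableB ax axh) sh.
have [iby ey] := gy_mean c gt (vmeasurableB ayh ay) sh'.
set bx := fun w => dot _ (x k t w - xhat k w) in ibx ex.
set by_ := fun w => dot _ (yhat k w - y k t w) in iby ey.
have sqi d' (z z' : Omega -> 'rV[R]_d') : sqintegrable P z -> sqintegrable P z' ->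
    P.-integrable setT (EFin \o (fun w => enorm (z w - z' w) ^+ 2)).
  by move=> sz sz'; have [] := sqintegrableB sz sz'.
pose alx := (2 * (4 / (rho * k.+1%:R)))^-1.
pose aly := (2 * (2 / (lam * k.+1%:R)))^-1.
pose gx w := Gx (x k t w) (y k t w) (xi k t w).
pose gy w := Gy (x k t w) (y k t w) (xi k t w).
have I1 : 0 <= \sum_(p <- [:: (1, bx); (1, by_);
    (- lam, fun w => enorm (yhat k w - y k t w) ^+ 2);
    (- rho, fun w => enorm (xhat k w - x k 0%N w) ^+ 2);
    (rho, fun w => enorm (x k t w - x k 0%N w) ^+ 2)]) p.1 * \int[P]_w p.2 w.
  apply: Rintegral_lincomb_ge0 => [|w].
    by repeat split => //; exact: sqi.
  (* At each outcome the mean over a fresh sample is a genuine subgradient at the query point, so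
     the deterministic inequality applies. *)
  have [sxv syv _ _] := bounds c (Xx w) (Yy w).
  have := oracle_saddle_gap rho_gt0 f_wcvx f_sccv (saddle w kK) (Xx w) (Yy w) sxv syv.
  rewrite !big_cons big_nil /bx /by_ /= (enormB_sym (y k t w)).
  set px := dot _ (x k t w - xhat k w); set py := dot _ (yhat k w - y k t w).
  by clearbody px py; lra.
have I2 : 0 <= \sum_(p <- [:: (- 1, fun w => dot (gx w) (x k t w - xhat k w));
    (alx, fun w => enorm (xhat k w - x k t w) ^+ 2);
    (- (alx + rho), fun w => enorm (xhat k w - x k t.+1 w) ^+ 2);
    (rho, fun w => enorm (xhat k w - x k 0%N w) ^+ 2);
    (- rho, fun w => enorm (x k t.+1 w - x k 0%N w) ^+ 2);
    (4 / (rho * k.+1%:R) / 2, fun w => enorm (gx w) ^+ 2)]) p.1 * \int[P]_w p.2 w.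
  apply: Rintegral_lincomb_ge0 => [|w].
    by repeat split => //; try exact: sqi; [exact: integrable_dot|case: sgx].
  have [Xxh _ _] := saddle w kK.
  have := prox_step convexX (eta_x_gt0 k) (ltW rho_gt0) (x_step w c) Xxh.
  rewrite -/alx -/(gx w) !big_cons big_nil /=.
  by move: (alx) (4 / _ / 2) (dot (gx w) _) (enorm (gx w) ^+ 2) => al et e1 e2; lra.
have I3 : 0 <= \sum_(p <- [:: (- 1, fun w => dot (gy w) (yhat k w - y k t w));
    (aly, fun w => enorm (yhat k w - y k t w) ^+ 2);
    (- aly, fun w => enorm (yhat k w - y k t.+1 w) ^+ 2);
    (2 / (lam * k.+1%:R) / 2, fun w => enorm (gy w) ^+ 2)]) p.1 * \int[P]_w p.2 w.
  apply: Rintegral_lincomb_ge0 => [|w].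
    by repeat split => //; try exact: sqi; [exact: integrable_dot|case: sgy].
  have [_ Yyh _] := saddle w kK.
  have := prox_step convexY (eta_y_gt0 k) (lexx 0) (y_step w c) Yyh.
  rewrite -/aly -/(gy w) !big_cons big_nil /= (_ : dot (- _) _ = dot (gy w) (yhat k w - y k t w)).
    rewrite (_ : enorm (- gy w) ^+ 2 = enorm (gy w) ^+ 2); last by rewrite !sqr_enorm dotNl dotNr opprK.
    by move: (aly) (2 / _ / 2) (dot (gy w) _) (enorm (gy w) ^+ 2) => al et e1 e2; lra.
  by rewrite dotNl -dotNr opprB.
move: I1 I2 I3; rewrite !big_cons !big_nil /= ex ey.
rewrite -/(u t) -/(u t.+1) -/(v t) -/(v t.+1) -/(q t) -/(q t.+1) => I1 I2 I3.
have kk0 : 0 < k.+1%:R :> R by rewrite ltr0n.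
rewrite /alx in I2; rewrite /aly in I3.
move: (k.+1%:R) kk0 {alx aly} I2 I3 => kk kk0.
have -> : (2 * (4 / (rho * kk)))^-1 = rho * kk / 8 by field; rewrite !gt_eqF.
have -> : (2 * (2 / (lam * kk)))^-1 = lam * kk / 4 by field; rewrite !gt_eqF.
(* The noise of a step is eta_x/2 M1^2 + eta_y/2 M2^2; this is where [sigma] comes from. *)
have -> : sigma / kk = 4 / (rho * kk) / 2 * M1 ^+ 2 + 2 / (lam * kk) / 2 * M2 ^+ 2.
  by field; rewrite !gt_eqF.
have ex0 : 0 <= 4 / (rho * kk) / 2 by rewrite !divr_ge0 // ltW // mulr_gt0.
have ey0 : 0 <= 2 / (lam * kk) / 2 by rewrite !divr_ge0 // ltW // mulr_gt0.
have := ler_wpM2l ex0 gx2; have := ler_wpM2l ey0 gy2.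
move: I1 {gx2 gy2 ex0 ey0 ex ey}; move: (4 / (rho * kk) / 2) (2 / (lam * kk) / 2).
move: (rho * kk / 8) (lam * kk / 4) (u t) (u t.+1) (v t) (v t.+1) (q t) (q t.+1).
move: (\int[P]_w bx w) (\int[P]_w by_ w).
move: (\int[P]_w enorm (xhat k w - x k 0%N w) ^+ 2).
move: (\int[P]_w enorm (gx w) ^+ 2) (\int[P]_w enorm (gy w) ^+ 2).
move=> g1 g2 h b1 b2 c1 c2 u0 u1 v0 v1 q0 q1 e1 e2; lra.
Qed.

Lemma mean_sqr_le d' (z : Omega -> 'rV[R]_d') (p : nat -> Omega -> 'rV[R]_d')
    (pbar : Omega -> 'rV[R]_d') N : (0 < N)%N ->
  sqintegrable P z -> (forall t, (t < N)%N -> sqintegrable P (p t)) ->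
  (forall w, pbar w = N%:R^-1 *: \sum_(t < N) p t w) -> sqintegrable P pbar ->
  \int[P]_w enorm (z w - pbar w) ^+ 2 <=
  N%:R^-1 * \sum_(t < N) \int[P]_w enorm (z w - p t w) ^+ 2.
Proof.
move=> N0 sz sp pE sbar.
have ip t : (t < N)%N -> P.-integrable setT (EFin \o (fun w => enorm (z w - p t w) ^+ 2)).
  by move=> tN; have [] := sqintegrableB sz (sp t tN).
have [iS eS] := Rintegral_sum ip.
rewrite -eS -RintegralZl //; apply: le_Rintegral => //.
- by have [] := sqintegrableB sz sbar.
- have := integrable_lin N%:R^-1 0 iS iS; apply: eq_integrable => // w _ /=.
  by rewrite mul0r addr0.
move=> w _; rewrite pE; have N1 : N%:R != 0 :> R by rewrite pnatr_eq0 -lt0n.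
have -> : z w - N%:R^-1 *: \sum_(t < N) p t w = N%:R^-1 *: \sum_(t < N) (z w - p t w).
  rewrite sumrB scalerBr sumr_const card_ord -[z w *+ N]scaler_nat scalerA mulVf //.
  by rewrite scale1r.
exact: (sqr_enorm_mean (fun t => z w - p t w) N0).
Qed.

Lemma epoch_estimate :
  rho * u 0 / 50 + lam * v 0 / 100 + sigma / k.+1%:R >=
  rho * (\int[P]_w enorm (xhat k w - x k.+1 0%N w) ^+ 2) +
  lam * (\int[P]_w enorm (yhat k w - y k.+1 0%N w) ^+ 2).
Proof.
have kK1 : (0 < k)%N by case/andP: kK.
have gt t (tT : (t < T k)%N) := regular_epoch kK g0 (ltnW tT).
have [_ _ _ _ [sx1 sy1]] := regular_next kK g0.
have ex := mean_sqr_le (nb_steps_gt0 R k) (xhat_sqintegrable kK)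
  (fun t tT => (let: And5 _ _ _ _ s := gt t tT in s).1)
  (fun w => let: And4 _ _ _ h := run w in (h k kK).1) sx1.
have ey := mean_sqr_le (nb_steps_gt0 R k) (yhat_sqintegrable kK)
  (fun t tT => (let: And5 _ _ _ _ s := gt t tT in s).2)
  (fun w => let: And4 _ _ _ h := run w in (h k kK).2) sy1.
have /andP[hT _] := nb_steps_itv R k.
have int_ge0 d' (z : Omega -> 'rV[R]_d') : 0 <= \int[P]_w enorm (z w) ^+ 2.
  by apply: Rintegral_ge0 => w _; exact: sqr_ge0.
have q0 : q 0%N = 0.
  rewrite /q; under eq_Rintegral do rewrite subrr enorm0 expr0n.
  by rewrite Rintegral_cst // mul0r.
have ax0 : 0 <= rho * k.+1%:R / 8 by rewrite divr_ge0 // mulr_ge0 // ltW.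
have ay0 : 0 <= lam * k.+1%:R / 4 by rewrite divr_ge0 // mulr_ge0 // ltW.
have tele := telescope_steps (ltW rho_gt0) ax0 ay0 q0 (fun t => int_ge0 _ _)
  (fun t => int_ge0 _ _) (fun t => int_ge0 _ _) expected_step.
have := epoch_contraction kK1 (ltW rho_gt0) (ltW lam_gt0) (int_ge0 _ _)
  (int_ge0 _ _) hT tele.
apply: le_trans; apply: lerD; apply: ler_wpM2l => //; exact: ltW.
Qed.

End Epoch.

(** * Summation over the epochs *)

Local Notation A k := (rho * \int[P]_w enorm (xhat k w - x k 0%N w) ^+ 2).
Local Notation B k := (lam * \int[P]_w enorm (yhat k w - y k 0%N w) ^+ 2).

(** The saddle values telescope along each outcome. The last one pairs the saddle point of epoch j +
    1 with the next centre, since for j + 1 = K there is no further saddle point to pass to. *)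
Lemma potential_decrease w j : (j < K)%N ->
  \sum_(i < j.+1) (rho * enorm (xhat i.+1 w - x i.+1 0%N w) ^+ 2
                   - rho * enorm (xhat i.+1 w - x i.+2 0%N w) ^+ 2) <=
  f (xhat 1%N w) (yhat 1%N w) + rho * enorm (xhat 1%N w - x 1%N 0%N w) ^+ 2
  - (f (xhat j.+1 w) (yhat j.+1 w) + rho * enorm (xhat j.+1 w - x j.+2 0%N w) ^+ 2).
Proof.
elim: j => [|j IH] jK.
  by rewrite big_ord_recr big_ord0 /=; lra.
have := IH (ltnW jK).
have := prox_saddle_value_le (saddle w (_ : (1 <= j.+1 <= K)%N))
  (saddle w (_ : (1 <= j.+2 <= K)%N)).
move=> /(_ (ltnW jK) jK).
by rewrite [in X in _ -> _ -> X]big_ord_recr /=; lra.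
Qed.

Lemma run_bound : (0 < K)%N -> 0 <= eps0 ->
  \sum_(i < K) A i.+1 <= 2 * eps0 + 2 * sigma * \sum_(i < K) i.+2%:R^-1.
Proof.
move=> K0 e0; have int_ge0 d' (z : Omega -> 'rV[R]_d') : 0 <= \int[P]_w enorm (z w) ^+ 2.
  by apply: Rintegral_ge0 => w _; exact: sqr_ge0.
have sqi d' (z z' : Omega -> 'rV[R]_d') : sqintegrable P z -> sqintegrable P z' ->
    P.-integrable setT (EFin \o (fun w => enorm (z w - z' w) ^+ 2)).
  by move=> sz sz'; have [] := sqintegrableB sz sz'.
have gs k : (k <= K)%N -> sqintegrable P (x k.+1 0%N) /\ sqintegrable P (y k.+1 0%N).
  by move=> kK; have [] // := regular_start (k := k.+1).
apply: (@sum_recursion _ K (fun i => A i.+1) (fun i => B i.+1)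
  (fun i => rho * \int[P]_w enorm (xhat i.+1 w - x i.+2 0%N w) ^+ 2)
  (fun i => lam * \int[P]_w enorm (yhat i.+1 w - y i.+2 0%N w) ^+ 2)
  (fun i => i.+2%:R^-1) eps0 sigma) => //.
- by move=> k; exact: mulr_ge0 (ltW rho_gt0) (int_ge0 _ _).
- by move=> k; exact: mulr_ge0 (ltW lam_gt0) (int_ge0 _ _).
- by move=> k; exact: mulr_ge0 (ltW rho_gt0) (int_ge0 _ _).
- by move=> k; exact: mulr_ge0 (ltW lam_gt0) (int_ge0 _ _).
- exact: (noise_level_ge0 M1 M2 rho_gt0 lam_gt0).
- have iD i : (i < K)%N -> P.-integrable setT (EFin \o (fun w =>
      rho * enorm (xhat i.+1 w - x i.+1 0%N w) ^+ 2
      + (- rho) * enorm (xhat i.+1 w - x i.+2 0%N w) ^+ 2)).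
    move=> iK; apply: integrable_lin; apply: sqi; try exact: xhat_sqintegrable.
      by have [] := gs i (ltnW iK).
    by have [] := gs i.+1 iK.
  have [iS eS] := Rintegral_sum iD.
  rewrite (_ : \sum_(k < K) _ = \int[P]_w (\sum_(i < K)
      (rho * enorm (xhat i.+1 w - x i.+1 0%N w) ^+ 2
      + (- rho) * enorm (xhat i.+1 w - x i.+2 0%N w) ^+ 2))); last first.
    rewrite eS; apply: eq_bigr => i _; have iK := ltn_ord i.
    rewrite Rintegral_lin ?mulNr //; apply: sqi; try exact: xhat_sqintegrable.
      by have [] := gs i (ltnW iK).
    by have [] := gs i.+1 iK.
  have -> : eps0 = \int[P]_w eps0.
    by rewrite Rintegral_const.
  apply: le_Rintegral => //; first exact: integrable_const.
  move=> w _; have [K' KE] : exists K', K = K'.+1 by exists K.-1; rewrite prednK.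
  have := @potential_decrease w K' (_ : (K' < K)%N); rewrite {1}KE => /(_ (ltnSn _)).
  rewrite -KE; under [in X in _ -> X]eq_bigr do rewrite mulNr.
  move/le_trans; apply.
  have s1 := saddle w (_ : (1 <= 1 <= K)%N); have {}s1 := s1 K0.
  have sK := saddle w (_ : (1 <= K <= K)%N); have {sK} := sK (_ : (1 <= K <= K)%N).
  rewrite leqnn K0 => /(_ isT) sK.
  have [Xx1 Yy1 m1] := s1; have [XxK YyK mK] := sK.
  have [[x1 _] _ _ _] := run w.
  (* The first saddle value is at most f x0 (yhat 1), by testing with [x0], and the last f-value is
     at least f (xhat K) y0, by testing with [y0]; their difference is at most the initial gap. *)
  have := gap_le gap0 XxK Yy1; have [_] := m1 _ _ Xx0 Yy1.
  rewrite x1 subrr enorm0 expr0n mulr0 addr0.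
  have [+ _] := mK _ _ XxK Yy0; rewrite lerD2r.
  have : 0 <= rho * enorm (xhat K w - x K.+1 0%N w) ^+ 2.
    exact: mulr_ge0 (ltW rho_gt0) (sqr_ge0 _).
  lra.
- have k1 : (1 <= 1 <= K)%N by rewrite K0.
  have [_ sy0] := gs 0%N (leq0n _).
  rewrite -RintegralZl //; last exact: sqi (yhat_sqintegrable k1) sy0.
  have -> : 2 * eps0 = \int[P]_w (2 * eps0).
    by rewrite Rintegral_const.
  apply: le_Rintegral => //; [|exact: integrable_const|move=> w _].
    have iy := sqi _ _ _ (yhat_sqintegrable k1) sy0.
    have := integrable_lin lam 0 iy iy; apply: eq_integrable => // w _ /=.
    by rewrite mul0r addr0.
  have [[x1 y1] _ _ _] := run w; have := saddle w k1; rewrite x1 y1 => s.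
  rewrite enormB_sym.
  exact: prox_saddle_init_gap rho_gt0 f_wcvx f_sccv _ _ _ _ _ Xx0 Yy0 gap0 s.
- move=> k kK; have k1 : (1 <= k.+1 <= K)%N by rewrite (ltnW kK).
  have k2 : (1 <= k.+2 <= K)%N by [].
  have [sx1 sy1] := gs k (ltnW (ltnW kK)); have [sx2 sy2] := gs k.+1 (ltnW kK).
  have [sxh syh] := (xhat_sqintegrable k1, yhat_sqintegrable k1).
  (* Split yh' - y0' at the previous [yh]: the part yh - y0' gives 2 b, and the drift satisfies 2
     lam |yh' - yh|^2 <= 2 rho |x0' - x0|^2 <= 4 A + 4 a. *)
  have : 0 <= \sum_(p <- [::
      (- lam, fun w => enorm (yhat k.+2 w - y k.+2 0%N w) ^+ 2);
      (2 * lam, fun w => enorm (yhat k.+1 w - y k.+2 0%N w) ^+ 2);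
      (4 * rho, fun w => enorm (xhat k.+1 w - x k.+1 0%N w) ^+ 2);
      (4 * rho, fun w => enorm (xhat k.+1 w - x k.+2 0%N w) ^+ 2)])
      p.1 * \int[P]_w p.2 w.
    apply: Rintegral_lincomb_ge0 => [|w].
      by repeat split => //; apply: sqi => //; exact: yhat_sqintegrable.
    rewrite !big_cons big_nil /=.
    have ly := prox_saddle_lip_y rho_gt0 f_wcvx f_sccv (saddle w k2) (saddle w k1).
    have hy := sqr_enormD_le (yhat k.+2 w - yhat k.+1 w) (yhat k.+1 w - y k.+2 0%N w).
    have hx := sqr_enormB_le (xhat k.+1 w - x k.+1 0%N w) (xhat k.+1 w - x k.+2 0%N w).
    rewrite addrA subrK in hy.
    rewrite (_ : _ - _ - _ = x k.+2 0%N w - x k.+1 0%N w) in hx; last first.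
      by rewrite opprB addrC addrA subrK.
    have := ler_wpM2l (ltW rho_gt0) hx; have := ler_wpM2l (ltW lam_gt0) hy; lra.
  rewrite !big_cons big_nil /=.
  move: (\int[P]_w enorm (yhat k.+2 w - y k.+2 0%N w) ^+ 2).
  move: (\int[P]_w enorm (yhat k.+1 w - y k.+2 0%N w) ^+ 2).
  move: (\int[P]_w enorm (xhat k.+1 w - x k.+1 0%N w) ^+ 2).
  move: (\int[P]_w enorm (xhat k.+1 w - x k.+2 0%N w) ^+ 2).
  by move=> c1 c2 c3 c4; lra.
- by move=> k kK; exact: epoch_estimate.
Qed.

End Run.

(** * The random epoch and the theorem *)

Section RandomIndex.
Variables (R : realType) (dO dT : measure_display).
Variables (Omega : measurableType dO) (T : measurableType dT).
Variables (P : probability Omega R) (Z : {RV P >-> T}) (tau : {RV P >-> nat}).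
Hypothesis indep : forall A B, measurable A -> measurable B ->
  P (Z @^-1` A `&` tau @^-1` B) = (P (Z @^-1` A) * P (tau @^-1` B))%E.
Variable K : nat.
Hypothesis unif : uniform_index P K tau.

Lemma Rintegral_index k : (1 <= k <= K)%N ->
  P.-integrable setT (EFin \o (fun w => \1_[set k] (tau w) : R)) /\
  \int[P]_w \1_[set k] (tau w) = K%:R^-1.
Proof.
move=> kK; have e : (fun w => \1_[set k] (tau w)) = \1_(tau @^-1` [set k]) :> (Omega -> R).
  by apply/funext => w; rewrite !indicE; congr (_%:R); apply/idP/idP => /set_mem h; exact/mem_set.
have mk : measurable (tau @^-1` [set k]) by exact: measurable_funPTI.
rewrite e; split; first exact: integrable_indic.
rewrite /Rintegral integral_indic // setIT.
by transitivity (fine (K%:R^-1 : R)%:E) => //; congr fine; exact: unif.2.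
Qed.

(** Decompose over the value of [tau]: each F k times the indicator of tau = k is a product of
    independent factors, and the indicator has mean 1/K. Epochs run from 1 to K, hence the shift to
    i.+1. *)
Lemma random_index_mean (F : nat -> T -> R) :
  (forall k, (1 <= k <= K)%N -> measurable_fun setT (F k)) ->
  (forall k z, 0 <= F k z) ->
  (forall k, (1 <= k <= K)%N -> P.-integrable setT (EFin \o (fun w => F k (Z w)))) ->
  P.-integrable setT (EFin \o (fun w => F (tau w) (Z w))) /\
  \int[P]_w F (tau w) (Z w) = K%:R^-1 * \sum_(i < K) \int[P]_w F i.+1 (Z w).
Proof.
move=> mF F0 iF.
pose G i w := F i.+1 (Z w) * \1_[set i.+1] (tau w).
have GE : (fun w => F (tau w) (Z w)) = fun w => \sum_(i < K) G i w.
  apply/funext => w; have := unif.1 w; case E : (tau w) => [//|j] /= jK.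
  rewrite (bigD1 (Ordinal jK)) //= /G big1 ?addr0.
    by rewrite E indicE mem_set // mulr1.
  move=> i ij; rewrite E indicE memNset ?mulr0 // => -[ji].
  by move: ij; rewrite -val_eqE /= ji eqxx.
have ind01 i w : `|F i.+1 (Z w) * \1_[set i.+1] (tau w)| <= F i.+1 (Z w).
  rewrite ger0_norm ?mulr_ge0 // indicE; case: (_ \in _).
    by rewrite mulr1.
  by rewrite mulr0.
have step i : (i < K)%N -> P.-integrable setT (EFin \o G i) /\
    \int[P]_w G i w = K%:R^-1 * \int[P]_w F i.+1 (Z w).
  move=> iK; have kK : (1 <= i.+1 <= K)%N by [].
  have [i1 e1] := Rintegral_index kK.
  have mG : measurable_fun setT (fun z : T * nat => F i.+1 z.1 * \1_[set i.+1] z.2 : R).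
    apply: measurable_funM; first by apply: measurableT_comp => //; exact: mF.
    by apply: measurableT_comp => //; exact: measurable_indic.
  have iG : P.-integrable setT (EFin \o G i).
    have mp : measurable_fun setT (fun w => (Z w, tau w)) by exact: measurable_fun_pair.
    exact: (integrable_le (measurableT_comp mG mp) (ind01 i) (iF _ kK)).
  split => //.
  have [] // := integral_indep indep mG iG.
    move=> w /=; have := integrable_lin (F i.+1 (Z w)) 0 i1 i1.
    by apply: eq_integrable => // w' _ /=; rewrite mul0r addr0.
  move=> _ /= ->; rewrite -RintegralZl //; last exact: iF.
  by apply: eq_Rintegral => w _; rewrite RintegralZl // e1 mulrC.
rewrite GE; have [iS ->] := Rintegral_sum (fun i iK => (step i iK).1).
split => //; rewrite mulr_sumr; apply: eq_bigr => i _.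
exact: (step i (ltn_ord i)).2.
Qed.

End RandomIndex.

(* The integrand [dist0 _] of the theorem need not be measurable, which rules
   out [ge0_le_integral]. *)
Lemma ge0_integral_mono (R : realType) (dT : measure_display) (T : measurableType dT)
    (P : probability T R) (g h : T -> \bar R) :
  (forall w, 0 <= g w)%E -> (forall w, g w <= h w)%E ->
  (\int[P]_w g w <= \int[P]_w h w)%E.
Proof.
move=> g0 gh; have h0 w : (0 <= h w)%E := le_trans (g0 w) (gh w).
rewrite !ge0_integralTE //; apply: ereal_sup_le => _ [s sg <-].
by exists s => // w; exact: le_trans (sg w) (gh w).
Qed.

(** The left side is at most 8 rho eps0 / K + 8 rho sigma H / K; the two conditions on K bound these
    by 40/2752 and 24/3392 of eps^2. *)
Lemma epochs_suffice (R : realType) (rho sigma eps eps0 K H s : R) :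
  0 < rho -> 0 < eps -> 0 < K ->
  rho * s <= 2 * eps0 + 2 * sigma * H ->
  1376 * (2 * rho) * eps0 / (5 * eps ^+ 2) <= K ->
  1696 * (2 * rho) * sigma / eps ^+ 2 * H <= 3 * K ->
  (2 * rho) ^+ 2 * (K^-1 * s) <= eps ^+ 2.
Proof.
move=> r0 e0 K0 hs hE hD.
have e20 : 0 < eps ^+ 2 by rewrite exprn_gt0.
have e5 : 0 < 5 * eps ^+ 2 by rewrite mulr_gt0 // ltr0n.
rewrite ler_pdivrMr // in hE.
rewrite mulrAC ler_pdivrMr // in hD.
rewrite mulrCA ler_pdivrMl //.
have := ler_wpM2l (ltW r0) hs; have := mulr_gt0 K0 e20; move: hE hD.
move: (eps ^+ 2) => e2 *; lra.
Qed.

Theorem theorem2 (R : realType) (d n : nat)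
    (X : set 'rV[R]_d) (Y : set 'rV[R]_n) (f : 'rV[R]_d -> 'rV[R]_n -> R)
    (rho lam gamma M1 M2 eps0 : R) (x0 : 'rV[R]_d) (y0 : 'rV[R]_n)
    (closedX : closed X) (convexX : convex_set X)
    (closedY : closed Y) (convexY : convex_set Y)
    (f_cont : {within X `*` Y, continuous (fun z => f z.1 z.2)})
    (rho_gt0 : 0 < rho) (lam_gt0 : 0 < lam)
    (f_wcvx : forall y, Y y -> weakly_convex rho X (fun x => f x y))
    (f_sccv : forall x, X x -> strongly_concave lam Y (fun y => f x y))
    (Xx0 : X x0) (Yy0 : Y y0)
    (eps0_gt0 : 0 < eps0) (gap0 : (gap X Y f x0 y0 <= eps0%:E)%E)
    (gammaE : gamma = 2 * rho) :
  (forall (eps : R) (dO dS : measure_display)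
      (Omega : measurableType dO) (S : measurableType dS)
      (P : probability Omega R)
      (Gx : 'rV[R]_d -> 'rV[R]_n -> S -> 'rV[R]_d)
      (Gy : 'rV[R]_d -> 'rV[R]_n -> S -> 'rV[R]_n)
      (xi : nat -> nat -> {RV P >-> S}) (tau : {RV P >-> nat})
      (x : nat -> nat -> Omega -> 'rV[R]_d)
      (y : nat -> nat -> Omega -> 'rV[R]_n)
      (xhat : nat -> Omega -> 'rV[R]_d) (yhat : nat -> Omega -> 'rV[R]_n),
    let K := nb_epochs rho lam gamma M1 M2 eps0 eps in
    0 < eps ->
    measurable_oracle X Y Gx -> measurable_oracle X Y Gy ->
    (forall k t, calls R K (k, t) ->
      oracle_bounds X Y f M1 M2 P Gx Gy (xi k t)) ->
    fresh_samples P K (fun k t => xi k t : Omega -> S) ->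
    (forall w, epoch_GDA X Y rho lam gamma K x0 y0 Gx Gy
      (fun k t => xi k t w) (fun k t => x k t w) (fun k t => y k t w)) ->
    uniform_index P K tau ->
    independent P (sigma_of tau)
      (sigma_of_family (fun k t => xi k t : Omega -> S) (calls R K)) ->
    (forall k w, (1 <= k <= K)%N ->
      is_saddle X Y (fun u v => f u v + gamma / 2 * enorm (u - x k 0%N w) ^+ 2)
        (xhat k w) (yhat k w)) ->
    (\int[P]_w (dist0 (limiting_subdiff (primal X Y f) (xhat (tau w) w)) ^+ 2)
     <= (gamma ^+ 2)%:E
        * 'E_P[fun w => (enorm (xhat (tau w) w - x (tau w) 0%N w) ^+ 2)%R])%E /\
    ((gamma ^+ 2)%:E
        * 'E_P[fun w => (enorm (xhat (tau w) w - x (tau w) 0%N w) ^+ 2)%R]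
     <= (eps ^+ 2)%:E)%E) /\
  soft_O (fun eps => (total_steps rho lam gamma M1 M2 eps0 eps)%:R)
         (fun eps => (eps ^+ 4)^-1).
Proof.
subst gamma; have gamma_gt0 : 0 < 2 * rho by rewrite mulr_gt0.
split; last exact: total_steps_soft_O.
move=> eps dO dS Omega S P Gx Gy xi tau x y xhat yhat K eps_gt0 mGx mGy bounds fresh
  run unif indep_tau sad.
have K0 : (0 < K)%N by exact: nb_epochs_gt0.
have saddle k w : (1 <= k <= K)%N ->
    prox_saddle X Y f rho (x k 0%N w) (xhat k w) (yhat k w).
  by move=> kK; have := sad k w kK; rewrite mulrAC divff // mul1r.
(* The whole run, saddle points included, is determined by these calls, and [tau] is independent of
   all of them. *)
pose I := calls R K.
pose F k w := enorm (xhat k w - x k 0%N w) ^+ 2.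
have indep A B : (measurable : set (set (past xi I))) A -> measurable B ->
    P (past_id xi I @^-1` A `&` tau @^-1` B) =
    (P (past_id xi I @^-1` A) * P (tau @^-1` B))%E.
  move=> mA mB; rewrite setIC muleC; apply: indep_tau => //.
  by exists B => //; rewrite setTI.
have sub k : calls_before R K k 0 `<=` I by move=> i [].
have leS k : (1 <= k <= K)%N -> (1 <= k <= K.+1)%N by case/andP => -> /leqW.
have start k (kK : (1 <= k <= K)%N) := regular_start closedX convexX closedY convexY
  rho_gt0 lam_gt0 Xx0 Yy0 mGx mGy bounds fresh run (leS k kK).
have mF k : (1 <= k <= K)%N -> measurable_fun setT (F k : past xi I -> R).
  move=> kK; apply: measurable_sqr_enorm; apply: vmeasurableB.
    apply: adaptedS (@sub k) _.
    exact: (xhat_adapted closedX convexX closedY convexY rho_gt0 lam_gt0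
      f_wcvx f_sccv Xx0 Yy0 mGx mGy bounds fresh run saddle kK).
  by apply: adaptedS (@sub k) _; have [] := start k kK.
have iF k : (1 <= k <= K)%N -> P.-integrable setT (EFin \o (fun w => F k (past_id xi I w))).
  move=> kK; have [_ _ _ _ [sx _]] := start k kK.
  have sxh := xhat_sqintegrable closedX convexX closedY convexY rho_gt0 lam_gt0
      f_wcvx f_sccv Xx0 Yy0 mGx mGy bounds fresh run saddle kK.
  by have [] := sqintegrableB sxh sx.
have F0 k w : 0 <= F k w by exact: sqr_ge0.
have [iT eT] := random_index_mean indep unif mF F0 iF.
have EE : ('E_P[fun w => (enorm (xhat (tau w) w - x (tau w) 0%N w) ^+ 2)%R])%E =
    (K%:R^-1 * \sum_(i < K) \int[P]_w F i.+1 w)%:E.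
  by rewrite unlock -eT /Rintegral fineK // integrable_fin_num.
split.
  rewrite unlock -ge0_integralZl_EFin //; last 3 first.
  - by move=> w _; rewrite lee_fin; exact: F0.
  - exact: measurable_int iT.
  - exact: sqr_ge0.
  have d0 (A : set 'rV[R]_d) : (0 <= dist0 A)%E.
    by apply: le_ereal_inf_tmp => _ [v _ <-]; rewrite lee_fin enorm_ge0.
  apply: ge0_integral_mono => w; first by rewrite expe2 mule_ge0.
  have := dist0_primal rho_gt0 (saddle (tau w) w (unif.1 w)) => le.
  rewrite -EFinM -exprMn expe2 expr2 EFinM.
  exact: lee_pmul.
rewrite EE -EFinM lee_fin.
have [D0 _ /andP[hK _]] := nb_epochs_itv M1 M2 rho_gt0 lam_gt0 gamma_gt0 eps0_gt0 eps_gt0.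
move: hK; rewrite ge_max => /andP[hD hE].
have KR : 0 < K%:R :> R by rewrite ltr0n.
apply: (epochs_suffice rho_gt0 eps_gt0 KR _ hE (harmonic_epochs K0 D0 hD)).
(* With i counted from 0, epoch i + 1 contributes 1 / (i + 2), which is the harmonic sum of
   [harmonic_epochs]. *)
rewrite mulr_sumr; apply: (run_bound closedX convexX closedY convexY rho_gt0 lam_gt0
      f_wcvx f_sccv Xx0 Yy0 gap0 mGx mGy bounds fresh run saddle K0).
exact: ltW.
Qed.
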